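(* Let $p$ be even and consider the Rademacher-spiked tensor model. Let $\ell$ be an integer with $p/2 \le \ell \le n - p/2$, let $\mathbf{M}$ be the order-$\ell$ symmetric difference matrix of $\mathbf{Y}$, and let $d_\ell = \binom{n-\ell}{p/2}\binom{\ell}{p/2}$. For all $\lambda \ge 0$, \[\mathbb{P}_0\Big(\lambda_{\max}(\mathbf{M}) \ge \tfrac{\lambda d_\ell}{2}\Big) \vee \mathbb{P}_\lambda\Big(\lambda_{\max}(\mathbf{M}) \le \tfrac{\lambda d_\ell}{2}\Big) \le 2 n^\ell e^{-\lambda^2 d_\ell/8}.\] Consequently, the test that outputs $1$ if $\lambda_{\max}(\mathbf{M}) \ge \lambda d_\ell/2$ and $0$ otherwise achieves strong detection between $\mathbb{P}_0$ and $\mathbb{P}_\lambda$ whenever $\frac18\lambda^2 d_\ell - \ell\log n \to +\infty$ as $n \to \infty$.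
   Context: Rademacher-spiked tensor model: for $\lambda \ge 0$, draw $\mathbf{x}_*$ uniformly from $\{\pm1\}^n$ and set $\mathbf{Y} = \lambda \mathbf{x}_*^{\otimes p} + \mathbf{G}$, where $\mathbf{G} = \frac{1}{\sqrt{p!}}\sum_{\pi\in S_p}\widetilde{\mathbf{G}}^\pi$ with $\widetilde{\mathbf{G}}$ having i.i.d. $\mathcal{N}(0,1)$ entries and $\widetilde{\mathbf{G}}^\pi_{i_1,\ldots,i_p}=\widetilde{\mathbf{G}}_{i_{\pi(1)},\ldots,i_{\pi(p)}}$. $\mathbb{P}_\lambda$ denotes the law of $\mathbf{Y}$ ($\mathbb{P}_0$ is the null, pure-noise law). For $E = \{i_1,\ldots,i_p\} \subseteq [n]$ with distinct elements write $\mathbf{Y}_E = \mathbf{Y}_{i_1,\ldots,i_p}$ (well defined by symmetry); thus $\mathbf{Y}_E = \lambda \prod_{i\in E}(\mathbf{x}_* )_i + \mathbf{G}_E$ with $(\mathbf{G}_E)_{|E|=p}$ i.i.d. $\mathcal{N}(0,1)$. The order-$\ell$ symmetric difference matrix $\mathbf{M}$ is the symmetric $\binom{n}{\ell}\times\binom{n}{\ell}$ matrix indexed by subsets $S,T\subseteq[n]$ of size $\ell$ with $\mathbf{M}_{S,T} = \mathbf{Y}_{S\triangle T}$ if $|S \triangle T| = p$ and $0$ otherwise ($\triangle$ is symmetric difference). $\lambda_{\max}$ is the largest eigenvalue. A test $f$ achieves strong detection if $\mathbb{P}_\lambda(f(\mathbf{Y})=1)\to1$ and $\mathbb{P}_0(f(\mathbf{Y})=0)\to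 1$ as $n\to\infty$. *)

(* Defs.v *)
From HB Require Import structures.
From mathcomp Require Import all_boot all_order all_algebra.
From mathcomp Require Import all_classical all_reals all_analysis.

Set Implicit Arguments.
Unset Strict Implicit.
Unset Printing Implicit Defensive.

Import Order.TTheory GRing.Theory Num.Theory.
Import numFieldNormedType.Exports.

Local Open Scope classical_set_scope.
Local Open Scope ring_scope.

Definition ksets (n k : nat) := {E : {set 'I_n} | #|E| == k}.

Definition symdiff (n : nat) (S T : {set 'I_n}) : {set 'I_n} :=
  (S :\: T) :|: (T :\: S).

Definition symdiff_matrix (R : nzRingType) (n l p : nat) (y : {set 'I_n} -> R)
  : 'M[R]_#|{: ksets n l}| :=
  \matrix_(i, j)
    (let E := symdiff (val (enum_val i)) (val (enum_val j)) in
     if #|E| == p then y E else 0).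

(* Largest eigenvalue of a real square matrix: the supremum of its (real)
   eigenvalues (a maximum for real symmetric matrices). *)
Definition lambda_max (R : realType) (m : nat) (A : 'M[R]_m) : R :=
  sup [set a : R | eigenvalue A a].

Definition mutually_independent d (T : measurableType d) (R : realType)
  (P : probability T R) (I : finType) (X : I -> {RV P >-> R}) : Prop :=
  forall B : I -> set R, (forall i, measurable (B i)) ->
    P (\bigcap_(i in [set: I]) (X i @^-1` B i)) =
    (\big[*%E/1%E]_(i : I) P (X i @^-1` B i))%E.

Definition rad_spiked_model d (T : measurableType d) (R : realType)
  (P : probability T R) (n p : nat)
  (G : {set 'I_n} -> {RV P >-> R}) (x : 'I_n -> {RV P >-> R}) : Prop :=
  [/\ (forall E : {set 'I_n}, #|E| = p ->
         forall B : set R, measurable B ->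
           P (G E @^-1` B) = normal_prob 0 1 B),
      (forall i : 'I_n, P (x i @^-1` [set 1]) = (2^-1)%:E /\
                        P (x i @^-1` [set -1]) = (2^-1)%:E) &
      mutually_independent
        (fun k : (ksets n p + 'I_n)%type =>
           match k with inl E => G (val E) | inr i => x i end)].

Definition obs d (T : measurableType d) (R : realType) (P : probability T R)
  (n : nat) (G : {set 'I_n} -> {RV P >-> R}) (x : 'I_n -> {RV P >-> R})
  (lam : R) (w : T) : {set 'I_n} -> R :=
  fun E => lam * (\prod_(i in E) x i w) + G E w.

Definition dl (R : nzRingType) (n l p : nat) : R :=
  ('C(n - l, p./2) * 'C(l, p./2))%:R.

(* Main.v *)
(* Under the null, expand E tr M^(2k) over walks, each step carrying as label
   the symmetric difference E of its endpoints and a factor G_E. By Wick's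
   formula every pairing of the steps contributes at most m d_l^k: an opening step has
   d_l choices, and a closing step is forced by its label. Hence
   E tr M^(2k) <= m (2k)! (d_l/2)^k / k!, so that P(lambda_max >= t) is at most
   2 m exp(- t^2 / (2 d_l)) after summing Markov's inequality against the
   coefficients of cosh; the factor 2 is the loss in exp s <= 2 cosh s. Instead
   of summing over pairings, Hermite polynomials of the G_E serve as weights
   recording the steps that are still unpaired.
   Under the spiked law, test the quadratic form of M at the vector
   u_S = prod_(i in S) x_i: the signal is lambda d_l, and, conditionally on x,
   the noise is a centred Gaussian of variance at most d_l. *)
Require Import Defs.
From HB Require Import structures.
From mathcomp Require Import all_boot all_order all_algebra.
From mathcomp Require Import all_classical all_reals all_analysis.
From mathcomp Require Import measurable_realfun zify ring lra.

Set Implicit Arguments.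
Unset Strict Implicit.
Unset Printing Implicit Defensive.

Import Order.TTheory GRing.Theory Num.Theory.
Import numFieldNormedType.Exports.

Local Open Scope classical_set_scope.
Local Open Scope ring_scope.

(** * Largest eigenvalue and Rayleigh quotients *)

(** Many entries of M share one Gaussian, so they are far from independent; what makes up for it is
    that a label occurs at most once in each row. Hence at most m entries carry a given label, which
    is also what bounds the variance by d_l under the spike. Induction on the length of the walk
    does not close for the trace alone: removing the first step leaves an unpaired factor G_E. The
    moment bound is therefore proved against an arbitrary Hermite weight, and it depends on that
    weight only through its total degree. At degree 0 it is the 2k-th moment of a scalar centred
    Gaussian of variance d_l, times m after taking the trace, hence the sub-Gaussian tail. Both
    errors have the same exponent because the threshold lies halfway between 0 and the signal lambda
    d_l: either side needs a deviation t = lambda d_l / 2, and t^2 / (2 d_l) = lambda^2 d_l / 8. The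
    dimension factor, bounded by n^l, comes from the null side. *)

Section Rayleigh.
Variables (R : realType) (m : nat).
Implicit Types (u v w : 'rV[R]_m) (A : 'M[R]_m).

Definition dot u v : R := (u *m v^T) 0 0.

Lemma dotE u v : dot u v = \sum_i u 0 i * v 0 i.
Proof. by rewrite /dot mxE; apply: eq_bigr => i _; rewrite mxE. Qed.

Lemma dotC u v : dot u v = dot v u.
Proof. by rewrite !dotE; apply: eq_bigr => i _; rewrite mulrC. Qed.

Lemma dotDl u v w : dot (u + v) w = dot u w + dot v w.
Proof. by rewrite /dot mulmxDl mxE. Qed.

Lemma dotZl a u v : dot (a *: u) v = a * dot u v.
Proof. by rewrite /dot -scalemxAl mxE. Qed.

Lemma dotDr u v w : dot u (v + w) = dot u v + dot u w.
Proof. by rewrite dotC dotDl !(dotC u). Qed.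

Lemma dotZr a u v : dot u (a *: v) = a * dot u v.
Proof. by rewrite dotC dotZl dotC. Qed.

Lemma dotNl u v : dot (- u) v = - dot u v.
Proof. by rewrite -scaleN1r dotZl mulN1r. Qed.

Lemma dot_ge0 u : 0 <= dot u u.
Proof. by rewrite dotE sumr_ge0// => i _; rewrite -expr2 sqr_ge0. Qed.

Lemma dot_eq0 u : (dot u u == 0) = (u == 0).
Proof.
apply/idP/eqP => [|->]; last by rewrite /dot mul0mx mxE.
rewrite dotE psumr_eq0 => [/allP h|i _]; last by rewrite -expr2 sqr_ge0.
apply/rowP => i; rewrite mxE.
by have := h i (mem_index_enum _); rewrite /= mulf_eq0 orbb => /eqP.
Qed.

Lemma dot_gt0 u : (0 < dot u u) = (u != 0).
Proof. by rewrite lt_neqAle dot_ge0 andbT eq_sym dot_eq0. Qed.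

Lemma sqr_dot_le u v : dot v v = 1 -> dot v u ^+ 2 <= dot u u.
Proof.
move=> v1; have := dot_ge0 (u + (- dot v u) *: v).
by rewrite !(dotDl, dotDr, dotZl, dotZr) v1 (dotC u v) expr2; lra.
Qed.

Lemma dot_symmx A u v : A^T = A -> dot (u *m A) v = dot u (v *m A).
Proof. by move=> sA; rewrite /dot trmx_mul sA mulmxA. Qed.

Lemma continuous_quadform A : continuous (fun u => dot (u *m A) u).
Proof.
have -> : (fun u => dot (u *m A) u) =
  (fun u => \sum_i (\sum_j u 0 j * A j i) * u 0 i).
  by apply/funext => u; rewrite dotE; apply: eq_bigr => i _; rewrite mxE.
apply: (@continuous_big R^o _ +%R 0 xpredT (@add_continuous R^o)) => i _ u.
apply: (@continuousM _ _ _ (fun u : 'rV_m => u 0 i)); last exact: coord_continuous.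
apply: (@continuous_big R^o _ +%R 0 xpredT (@add_continuous R^o)) => j _ {}u.
by apply: (@continuousM _ _ (fun u : 'rV_m => u 0 j) (fun=> A j i)); [exact: coord_continuous|exact: cst_continuous].
Qed.

(** A maximiser [v] of the quadratic form on the compact unit sphere is a critical point: moving it
    along the residual [w = v A - mu v] would increase the Rayleigh quotient unless [w = 0]. *)
Lemma rayleigh_max A : (0 < m)%N -> A^T = A ->
  exists2 v, dot v v = 1 &
    v *m A = dot (v *m A) v *: v /\
    forall u, dot (u *m A) u <= dot (v *m A) v * dot u u.
Proof.
move=> m0 sA; pose S := [set u | dot u u = 1].
have cS : closed S.
  have -> : S = (fun u => dot (u *m 1%:M) u) @^-1` [set 1].
    by apply/seteqP; split => u /=; rewrite mulmx1.
  by apply: closed_comp => [u _|]; [exact: continuous_quadform|exact: closed_eq].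
have bS : bounded_set S.
  exists 1; split => // z z1 u /= Su; apply: le_trans (ltW z1).
  rewrite /Num.norm/= mx_normrE; apply: bigmax_le => // -[i j] _ /=.
  rewrite (ord1 i) -(@ler_pXn2r _ 2%N)// ?nnegrE// expr1n real_normK ?num_real//.
  rewrite -Su dotE (bigD1 j)//= -expr2 lerDl sumr_ge0// => k _.
  by rewrite -expr2 sqr_ge0.
have S0 : S !=set0.
  exists (delta_mx 0 (Ordinal m0)) => /=.
  rewrite /S/= dotE (bigD1 (Ordinal m0))//= big1 ?addr0 ?mxE ?eqxx ?mulr1//.
  by move=> i ii0; rewrite mxE (negbTE ii0) andbF mulr0.
have cf : {within S, continuous (fun u => dot (u *m A) u)}.
  by apply: continuous_subspaceT; exact: continuous_quadform.
have [v vS vmax] := EVT_max_rV S0 (bounded_closed_compact bS cS) cf.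
have {vS}v1 : dot v v = 1 by rewrite inE in vS.
set mu := dot (v *m A) v in vmax *.
have bound u : dot (u *m A) u <= mu * dot u u.
  have [->|u0] := eqVneq u 0; first by rewrite mul0mx /dot !mul0mx !mxE mulr0.
  have nu : 0 < dot u u by rewrite dot_gt0.
  pose t := (Num.sqrt (dot u u))^-1.
  have tt : t * t = (dot u u)^-1.
    by rewrite -invfM -expr2 sqr_sqrtr// ltW.
  have := vmax (t *: u); rewrite inE /S/= -scalemxAl !dotZl !dotZr !mulrA tt.
  rewrite mulVf ?gt_eqF// => /(_ erefl).
  by rewrite mulrC ler_pdivrMr.
have key w s : s * (dot (v *m A) w - mu * dot v w) * 2 <=
    s ^+ 2 * (mu * dot w w - dot (w *m A) w).
  have := bound (v + s *: w).
  rewrite mulmxDl -scalemxAl !(dotDl, dotDr, dotZl, dotZr) v1 -/mu.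
  by rewrite (dotC w v) (dot_symmx _ _ sA) (dotC w (v *m A)); lra.
exists v => //; split => //.
apply/eqP; rewrite -subr_eq0 -dot_eq0; set w := v *m A - mu *: v.
rewrite eq_le dot_ge0 andbT.
have {}key s : s * dot w w * 2 <= s ^+ 2 * (mu * dot w w - dot (w *m A) w).
  by have := key w s; rewrite -dotZl -dotNl -dotDl.
set b := dot w w in key *.
set c := mu * b - dot (w *m A) w in key.
have c0 : 0 <= c by rewrite subr_ge0.
(* The displacement is small against the curvature [c], so that the linear gain [2 s b] beats
   [s^2 c]; the [+ 1] covers [c = 0]. *)
have := key (b / (c + 1)).
have c1 : 0 < c + 1 by lra.
have b0 : 0 <= b := dot_ge0 w.
rewrite expr2; set q := b / (c + 1).
have bq : b = q * (c + 1) by rewrite divfK ?gt_eqF.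
have q0 : 0 <= q by rewrite divr_ge0// ltW.
rewrite bq => h; have : q * q * (c + 2) <= 0 by nra.
rewrite pmulr_lle0; last by lra.
move=> qq; have /eqP-> : q == 0 by rewrite -sqrf_eq0 expr2 eq_le qq mulr_ge0.
by rewrite mul0r.
Qed.

(** Identifies the supremum of the eigenvalues with an attained maximum; in dimension zero there are
    no eigenvalues, hence [0 < m]. *)
Lemma lambda_max_rayleigh A : (0 < m)%N -> A^T = A ->
  (exists2 v, dot v v = 1 & v *m A = lambda_max A *: v) /\
  forall u, dot (u *m A) u <= lambda_max A * dot u u.
Proof.
move=> m0 sA; have [v v1 [vA bnd]] := rayleigh_max m0 sA.
suff -> : lambda_max A = dot (v *m A) v by split => //; exists v.
have v0 : v != 0 by rewrite -dot_eq0 v1 oner_eq0.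
have ev : eigenvalue A (dot (v *m A) v) by apply/eigenvalueP; exists v.
have ub : ubound [set a | eigenvalue A a] (dot (v *m A) v).
  move=> a /= /eigenvalueP[u uA u0]; have := bnd u.
  by rewrite uA dotZl ler_pM2r// dot_gt0.
apply/eqP; rewrite eq_le; apply/andP; split.
  by apply: ge_sup => //; exists (dot (v *m A) v).
by apply: ub_le_sup => //; exists (dot (v *m A) v).
Qed.

Lemma lambda_max_le A c : (0 < m)%N -> A^T = A ->
  lambda_max A <= c <-> forall u, dot (u *m A) u <= c * dot u u.
Proof.
move=> m0 sA; have [[v v1 vA] bnd] := lambda_max_rayleigh m0 sA.
split=> [lc u|/(_ v)]; last by rewrite vA dotZl v1 !mulr1.
by apply: le_trans (bnd u) _; rewrite ler_wpM2r// dot_ge0.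
Qed.

(** Countably many test vectors suffice because a violated inequality stays violated on a
    neighbourhood; this is what makes the largest eigenvalue measurable. *)
Lemma lambda_max_le_rat A c : (0 < m)%N -> A^T = A ->
  lambda_max A <= c <-> forall q : 'rV[rat]_m,
    let u := map_mx (@ratr R) q in dot (u *m A) u <= c * dot u u.
Proof.
move=> m0 sA; rewrite lambda_max_le//; split=> [H q|H u]; first exact: H.
pose F := fun u => dot (u *m (A - c%:M)) u.
have FE w : (dot (w *m A) w <= c * dot w w) = (F w <= 0).
  by rewrite /F mulmxBr dotDl dotNl mul_mx_scalar dotZl subr_le0.
rewrite FE leNgt; apply/negP => Fu.
have /nbhs_ballP[e /= e0 eF] : nbhs u (F @^-1` [set x | 0 < x]).
  by apply: continuous_quadform; apply: open_nbhs_nbhs; split => //; exact: open_gt.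
have /choice[q Hq] : forall i, exists q : rat, u 0 i - e < ratr q < u 0 i + e.
  move=> i; have [|q] := @rat_in_itvoo R (u 0 i - e) (u 0 i + e); first by lra.
  by rewrite in_itv; exists q.
have /= := H (\row_i q i); rewrite FE leNgt => /negP; apply; apply: eF; split=> // i j.
rewrite (ord1 i) !mxE /ball/= ltr_norml; have /andP[h1 h2] := Hq j.
by apply/andP; split; lra.
Qed.

Lemma trmx_symX A k : A^T = A -> (A ^+ k)^T = A ^+ k.
Proof.
move=> sA; elim: k => [|k IH]; first by rewrite !expr0 trmx1.
by rewrite exprS -mulmxE trmx_mul IH sA mulmxE -exprSr exprS.
Qed.

Lemma mxtrace_symX2 A k : A^T = A ->
  \tr (A ^+ (2 * k)) = \sum_j dot (col j (A ^+ k))^T (col j (A ^+ k))^T.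
Proof.
move=> sA; rewrite mul2n -addnn exprD -[X in \tr (X * _)](trmx_symX k sA).
rewrite -mulmxE /mxtrace; apply: eq_bigr => j _.
by rewrite dotE mxE; apply: eq_bigr => i _; rewrite !mxE.
Qed.

(** The trace is the squared Frobenius norm of [A ^+ k]; Cauchy-Schwarz on each column bounds it
    below by the squared norm of [v *m A ^+ k], where [v] is a unit eigenvector for the largest
    eigenvalue. *)
Lemma lambda_max_pow_le_trace A t k : (0 < m)%N -> A^T = A ->
  0 <= t -> t <= lambda_max A -> t ^+ (2 * k) <= \tr (A ^+ (2 * k)).
Proof.
move=> m0 sA t0 tl; have [[v v1 vA] _] := lambda_max_rayleigh m0 sA.
set mu := lambda_max A in tl vA.
have vAk : v *m A ^+ k = mu ^+ k *: v.
  elim: k => [|k IH]; first by rewrite !expr0 mulmx1 scale1r.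
  by rewrite exprS -mulmxE mulmxA vA -scalemxAl IH scalerA -exprS.
apply: (@le_trans _ _ (mu ^+ (2 * k))).
  by rewrite lerXn2r// ?nnegrE// (le_trans t0).
rewrite mxtrace_symX2// mul2n -addnn exprD; set B := A ^+ k in vAk *.
have -> : mu ^+ k * mu ^+ k = dot (v *m B) (v *m B).
  by rewrite vAk dotZl dotZr v1 mulr1.
rewrite dotE; apply: ler_sum => j _.
have := sqr_dot_le (col j B)^T v1; rewrite expr2.
suff -> : dot v (col j B)^T = (v *m B) 0 j by [].
by rewrite dotE mxE; apply: eq_bigr => i _; rewrite !mxE.
Qed.
End Rayleigh.

(** * Expectations of products of independent random variables *)

Section WeightedIntegral.
Context d (T : measurableType d) (R : realType).
Variables (mu : {measure set T -> \bar R}) (nu : {measure set R -> \bar R}).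
Import HBNNSimple.

Lemma nnsfun_sumE (h : {nnsfun R >-> R}) : exists s : seq R,
  forall t, h t = \sum_(y <- s) `|y| * \1_(h @^-1` [set y]) t.
Proof.
exists (finmap.enum_fset (fset_set (range h))) => t.
rewrite {1}(fimfunE h t) fsbig_finite//=; apply: eq_big_seq => y.
rewrite in_fset_set// inE => -[z _ <-]; rewrite ger0_norm//.
Qed.

(** Passage from indicators to simple functions and then, by monotone convergence, to all
    nonnegative functions. It serves twice: for independence, [W] is the product of the other
    factors and [c] its expectation; for the Gaussian density, [X] is the identity, [W] the density
    and [c = 1]. *)
Lemma ge0_integral_weight_ext (X : T -> R) (W : T -> R) (c : \bar R) :
  measurable_fun setT X ->
  measurable_fun setT W -> (forall w, 0 <= W w) -> (0 <= c)%E -> c \is a fin_num ->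
  (forall B, measurable B ->
    \int[mu]_w (\1_B (X w) * W w)%:E = nu B * c)%E ->
  forall f : R -> R, measurable_fun setT f -> (forall t, 0 <= f t) ->
  (\int[mu]_w (f (X w) * W w)%:E = (\int[nu]_t (f t)%:E) * c)%E.
Proof.
move=> mX mW W0 c0 cfin HB f mf f0.
have mcomp (g : R -> R) : measurable_fun setT g ->
    measurable_fun setT (fun w => g (X w)).
  by move=> mg; exact: measurableT_comp.
have simple (h : {nnsfun R >-> R}) :
    (\int[mu]_w (h (X w) * W w)%:E = (\int[nu]_t (h t)%:E) * c)%E.
  have [s hE] := nnsfun_sumE h.
  have mi y : measurable_fun setT (fun w => \1_(h @^-1` [set y]) (X w) : R).
    by apply: (mcomp (\1_(h @^-1` [set y]))); exact: measurable_indic.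
  have mi0 y : measurable_fun setT (\1_(h @^-1` [set y]) : R -> R).
    exact: measurable_indic.
  under eq_integral => w _ do rewrite hE mulr_suml -sumEFin.
  under [in RHS]eq_integral => w _ do rewrite hE -sumEFin.
  rewrite !ge0_integral_sum//; last first.
  - by move=> y w _; rewrite lee_fin !mulr_ge0.
  - by move=> y; apply/measurable_EFinP/measurable_funM => //; exact: measurable_funM.
  - by move=> y; apply/measurable_EFinP/measurable_funM => //; exact: mi0.
  rewrite ge0_sume_distrl; last first.
    by move=> y _; rewrite integral_ge0// => t _; rewrite lee_fin mulr_ge0.
  apply: eq_bigr => y _; under eq_integral do rewrite -mulrA EFinM.
  under [in RHS]eq_integral do rewrite EFinM.
  rewrite !ge0_integralZl_EFin//; last first.
  - by apply/measurable_EFinP; exact: measurable_funM.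
  - by move=> w _; rewrite lee_fin mulr_ge0.
  - by apply/measurable_EFinP; exact: mi0.
  by rewrite -muleA HB// integral_indic// setIT.
pose fE := EFin \o f.
have mfE : measurable_fun setT fE by exact/measurable_EFinP.
pose h n := nnsfun_approx measurableT mfE n.
have fE0 x : [set: R] x -> (0 <= fE x)%E by rewrite lee_fin.
have hcvg x : EFin (h n x) @[n --> \oo] --> fE x.
  exact: (cvg_nnsfun_approx measurableT mfE fE0 (x := x)).
have hnd x n m : (n <= m)%N -> h n x <= h m x.
  by move=> nm; have /lefP := nd_nnsfun_approx measurableT mfE nm; exact.
have mono d' (T' : measurableType d') (m : {measure set T' -> \bar R})
    (Y V : T' -> R) : measurable_fun setT Y -> measurable_fun setT V ->
    (forall w, 0 <= V w) ->
    (\int[m]_w (h n (Y w) * V w)%:E)%E @[n --> \oo] -->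
    (\int[m]_w (f (Y w) * V w)%:E)%E.
  move=> mY mV V0.
  have := @cvg_monotone_convergence _ _ _ m setT measurableT
    (fun n w => (h n (Y w) * V w)%:E).
  have -> : (fun w => limn (fun n => (h n (Y w) * V w)%:E)) =
      (fun w => (f (Y w) * V w)%:E).
    apply/funext => w; apply/cvg_lim => //.
    under eq_fun do rewrite EFinM.
    by rewrite EFinM; apply: cvgeZr => //; exact: hcvg.
  apply.
  - move=> n; apply/measurable_EFinP/measurable_funM => //.
    exact: (measurableT_comp _ mY).
  - by move=> n w _; rewrite lee_fin mulr_ge0.
  - by move=> w _ n m' nm; rewrite lee_fin ler_wpM2r// hnd.
have := mono _ _ nu id (cst 1) (@measurable_id _ _ _) (measurable_cst _) (fun=> ler01).
under [in X in X @ _]eq_fun do under eq_integral do rewrite mulr1.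
under eq_integral do rewrite mulr1.
move=> l1; have := mono _ _ mu _ _ mX mW W0.
under eq_fun do rewrite simple.
move=> l2; apply: (cvg_unique _ l2) => //.
exact: cvgeZr.
Qed.

End WeightedIntegral.

Section Independence.
Context d (T : measurableType d) (R : realType) (P : probability T R).

Lemma integral_indic_rv (X : {RV P >-> R}) (B : set R) : measurable B ->
  (\int[P]_w (\1_B (X w))%:E = P (X @^-1` B))%E.
Proof.
move=> mB; rewrite -[X @^-1` B]setIT -integral_indic//.
by rewrite -[X in measurable X]setTI; exact: measurable_funP.
Qed.

(** Indicators are replaced by general functions one index at a time: [s] lists the indices whose
    factor is already arbitrary, and for empty [s] the claim is the definition of independence. *)
Lemma indep_ge0_integral (I : finType) (X : I -> {RV P >-> R}) :
  mutually_independent X -> forall f : I -> R -> R,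
  (forall i, measurable_fun setT (f i)) -> (forall i t, 0 <= f i t) ->
  (forall i, \int[P]_w (f i (X i w))%:E < +oo)%E ->
  (\int[P]_w (\prod_i f i (X i w))%:E = \prod_i \int[P]_w (f i (X i w))%:E)%E.
Proof.
move=> indX.
have mX i : measurable_fun setT (X i) by [].
have mcomp i (g : R -> R) : measurable_fun setT g ->
    measurable_fun setT (fun w => g (X i w)).
  by move=> mg; exact: measurableT_comp.
suff H (s : seq I) : forall f : I -> R -> R,
  (forall i, measurable_fun setT (f i)) -> (forall i t, 0 <= f i t) ->
  (forall i, \int[P]_w (f i (X i w))%:E < +oo)%E ->
  (forall i, i \notin s -> exists2 B, measurable B & f i = \1_B) ->
  (\int[P]_w (\prod_i f i (X i w))%:E = \prod_i \int[P]_w (f i (X i w))%:E)%E.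
  move=> f mf f0 foo; apply: (H (enum I)) => // i; by rewrite mem_enum.
elim: s => [|i0 s IH] f mf f0 foo fs.
  have /choice[B HB] : forall i, exists B, measurable B /\ f i = \1_B.
    by move=> i; have [//|B mB fB] := fs i; exists B.
  have := indX B (fun i => (HB i).1).
  have -> : (\prod_i P (X i @^-1` B i) = \prod_i \int[P]_w (f i (X i w))%:E)%E.
    by apply: eq_bigr => i _; rewrite (HB i).2 integral_indic_rv//; exact: (HB i).1.
  move=> <-.
  rewrite -[\bigcap_(i in [set: I]) X i @^-1` B i]setIT -integral_indic//.
  - apply: eq_integral => w _; congr EFin.
    under eq_bigr do rewrite (HB _).2.
    rewrite indicE; case: (pselect ((\bigcap_(i in [set: I]) X i @^-1` B i) w)) => Hw.
      rewrite mem_set// big1// => i _; rewrite indicE mem_set//; exact: Hw.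
    rewrite memNset//=; have /existsNP[i /not_implyP[_ Bi]] := Hw.
    by rewrite (bigD1 i)//= indicE memNset// mul0r.
  - apply: fin_bigcap_measurable => // i _.
    rewrite -[Y in measurable Y]setTI; apply: mX => //; exact: (HB i).1.
rewrite (bigD1 i0)//=.
have fge0 i : (0 <= \int[P]_w (f i (X i w))%:E)%E.
  by apply: integral_ge0 => w _; rewrite lee_fin.
have ffin i : (\int[P]_w (f i (X i w))%:E)%E \is a fin_num.
  by rewrite ge0_fin_numE.
under eq_integral do rewrite (bigD1 i0)//=.
rewrite -[X in _ = (X * _)%E](ge0_integral_distribution (X i0) (f := EFin \o f i0))//; last first.
- by move=> t; rewrite /= lee_fin.
- exact/measurable_EFinP.
apply: ge0_integral_weight_ext => //.
- under eq_fun do rewrite -big_filter.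
  by apply: measurable_prod => i _; exact: mcomp.
- by move=> w; exact: prodr_ge0.
- exact: prode_ge0.
- exact: prode_fin_num.
move=> B mB.
pose g i := if i == i0 then \1_B : R -> R else f i.
have gi0 : g i0 = \1_B by rewrite /g eqxx.
have gf i : i != i0 -> g i = f i by rewrite /g => /negbTE->.
have -> : (\prod_(i | i != i0) \int[P]_w (f i (X i w))%:E =
    \prod_(i | i != i0) \int[P]_w (g i (X i w))%:E)%E.
  by apply: eq_bigr => i ii0; rewrite gf.
have := IH g; rewrite (bigD1 i0)//= gi0 integral_indic_rv// => <-.
- apply: eq_integral => w _; rewrite [in RHS](bigD1 i0)//= gi0; congr (_ * _)%:E.
  by apply: eq_bigr => i ii0; rewrite (gf i ii0).
- move=> i; have [->|ii0] := eqVneq i i0; first by rewrite gi0; exact: measurable_indic.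
  by rewrite gf.
- by move=> i t; have [->|ii0] := eqVneq i i0; rewrite ?gi0// gf.
- move=> i; have [->|ii0] := eqVneq i i0; last by rewrite gf.
  by rewrite gi0 integral_indic_rv// (le_lt_trans (probability_le1 _ _))// ?ltry// -[Y in measurable Y]setTI; exact: mX.
- move=> i /negP is_; have [->|ii0] := eqVneq i i0; first by rewrite gi0; exists B.
  rewrite gf//; apply: fs; apply/negP; rewrite inE => /orP[/eqP ii|//].
  by rewrite ii eqxx in ii0.
Qed.

(* The nonnegative case is extended to signed factors one at a time, by
   splitting the factor into its positive and negative parts. *)
Lemma indep_integral (I : finType) (X : I -> {RV P >-> R}) :
  mutually_independent X -> forall f : I -> R -> R,
  (forall i, measurable_fun setT (f i)) ->
  (forall i, P.-integrable setT (EFin \o (f i \o X i))) ->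
  P.-integrable setT (EFin \o (fun w => \prod_i f i (X i w))) /\
  \int[P]_w (\prod_i f i (X i w)) = \prod_i \int[P]_w (f i (X i w)).
Proof.
move=> indX.
have mX i : measurable_fun setT (X i) by [].
have mcomp i (g : R -> R) : measurable_fun setT g ->
    measurable_fun setT (fun w => g (X i w)).
  by move=> mg; exact: measurableT_comp.
have prodI f : (forall i, measurable_fun setT (f i)) ->
    (forall i, P.-integrable setT (EFin \o (f i \o X i))) ->
    P.-integrable setT (EFin \o (fun w => \prod_i f i (X i w))).
  move=> mf fI; apply/integrableP; split.
    by apply/measurable_EFinP; apply: measurable_prod => i _; exact: mcomp.
  have foo i : (\int[P]_w `|f i (X i w)|%:E < +oo)%E.
    by have /integrableP[_] := fI i.
  under eq_integral do rewrite /= normr_prod.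
  rewrite (indep_ge0_integral indX (f := fun i t => `|f i t|))//.
    rewrite ltey_eq prode_fin_num// => i _; rewrite ge0_fin_numE//.
    exact: integral_ge0.
  by move=> i; exact: measurableT_comp.
move=> f mf fI; split; first exact: prodI.
suff H (s : seq I) : forall f : I -> R -> R,
  (forall i, measurable_fun setT (f i)) ->
  (forall i, P.-integrable setT (EFin \o (f i \o X i))) ->
  (forall i, i \notin s -> forall t, 0 <= f i t) ->
  \int[P]_w (\prod_i f i (X i w)) = \prod_i \int[P]_w (f i (X i w)).
  by apply: (H (enum I)) => // i; rewrite mem_enum.
elim: s {f mf fI} => [|i0 s IH] f mf fI fs.
  have foo i : (\int[P]_w (f i (X i w))%:E < +oo)%E.
    have /integrableP[_] := fI i; apply: le_lt_trans.
    under [leRHS]eq_integral do rewrite /= ger0_norm ?fs//.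
    exact: lexx.
  rewrite /Rintegral (indep_ge0_integral indX)//; last by move=> i; exact: fs.
  rewrite (eq_bigr (fun i => (fine (\int[P]_w (f i (X i w))%:E))%:E)) ?prodEFin//.
  move=> i _; rewrite fineK// ge0_fin_numE//; apply: integral_ge0 => w _.
  by rewrite lee_fin fs.
pose g (h : R -> R) i := if i == i0 then h else f i.
have gi0 h : g h i0 = h by rewrite /g eqxx.
have gf h i : i != i0 -> g h i = f i by rewrite /g => /negbTE->.
have key (h : R -> R) : measurable_fun setT h -> (forall t, 0 <= h t) ->
    P.-integrable setT (EFin \o (h \o X i0)) ->
    P.-integrable setT (EFin \o (fun w => h (X i0 w) * \prod_(i | i != i0) f i (X i w))) /\
    \int[P]_w (h (X i0 w) * \prod_(i | i != i0) f i (X i w)) =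
    \int[P]_w (h (X i0 w)) * \prod_(i | i != i0) \int[P]_w (f i (X i w)).
  move=> mh h0 hI.
  have mg i : measurable_fun setT (g h i).
    by have [->|ii0] := eqVneq i i0; rewrite ?gi0// gf.
  have gI i : P.-integrable setT (EFin \o (g h i \o X i)).
    by have [->|ii0] := eqVneq i i0; rewrite ?gi0// gf.
  have gE w : \prod_i g h i (X i w) = h (X i0 w) * \prod_(i | i != i0) f i (X i w).
    rewrite (bigD1 i0)//= gi0; congr (_ * _).
    by apply: eq_bigr => i ii0; rewrite gf.
  split.
    by have := prodI _ mg gI; under eq_fun do rewrite gE.
  have := IH _ mg gI.
  under eq_Rintegral do rewrite gE.
  move=> ->.
    rewrite (bigD1 i0)//= gi0; congr (_ * _).
    by apply: eq_bigr => i ii0; rewrite gf.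
  move=> i is_; have [->|ii0] := eqVneq i i0; rewrite ?gi0// gf//.
  by apply: fs; rewrite inE (negbTE ii0).
have pn_int (h : R -> R) : measurable_fun setT h ->
    (forall t, `|h t| <= `|f i0 t|) -> P.-integrable setT (EFin \o (h \o X i0)).
  move=> mh hf; apply: le_integrable (fI i0) => //.
    by apply/measurable_EFinP; exact: mcomp.
  by move=> w _; rewrite /= lee_fin; exact: hf.
have mp : measurable_fun setT (f i0)^\+ by exact: measurable_funrpos.
have mn : measurable_fun setT (f i0)^\- by exact: measurable_funrneg.
have abs_pn t : `|(f i0)^\+ t| <= `|f i0 t| /\ `|(f i0)^\- t| <= `|f i0 t|.
  have := congr1 (@^~ t) (funrposDneg (f i0)) => /= <-.
  by rewrite !ger0_norm// lerDl lerDr.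
have pI := pn_int _ mp (fun t => (abs_pn t).1).
have nI := pn_int _ mn (fun t => (abs_pn t).2).
have [pI' pE] := key _ mp (fun t => funrpos_ge0 _ _) pI.
have [nI' nE] := key _ mn (fun t => funrneg_ge0 _ _) nI.
have fE t : f i0 t = (f i0)^\+ t - (f i0)^\- t.
  by have := congr1 (@^~ t) (funrposBneg (f i0)) => /= <-.
rewrite (bigD1 i0)//=.
under eq_Rintegral do rewrite (bigD1 i0)//= fE mulrBl.
under [X in _ = X * _]eq_Rintegral do rewrite fE.
by rewrite !RintegralB// pE nE mulrBl.
Qed.
End Independence.

(** * Gaussian moments and Hermite polynomials *)

Section Gaussian.
Variable R : realType.
Local Notation mu := (@lebesgue_measure R).
Local Notation phi := (normal_pdf (0:R) 1).

(** Completing the square. The identity yields the moment generating function, and, with [s = 1] and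
    [s = -1], an integrable majorant of any polynomial times the density. *)
Lemma normal_pdf_shift (s x : R) :
  expR (s * x) * phi x = expR (s ^+ 2 / 2) * normal_pdf s 1 x.
Proof.
rewrite !normal_pdfE ?oner_eq0// /normal_fun mulrCA [RHS]mulrCA -!expRD.
by congr (_ * expR _); field.
Qed.

Lemma horner_expR_bound (q : {poly R}) :
  exists2 C, 0 <= C & forall x, `|q.[x]| <= C * (expR x + expR (- x)).
Proof.
exists (\sum_(i < size q) `|q`_i| * i`!%:R).
  by apply: sumr_ge0 => i _; exact: mulr_ge0.
move=> x; rewrite horner_coef mulr_suml; apply: le_trans (ler_norm_sum _ _ _) _.
apply: ler_sum => i _; rewrite normrM -mulrA ler_wpM2l// normrX.
apply: (@le_trans _ _ (i`!%:R * expR `|x|)).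
  rewrite mulrC -ler_pdivrMr ?ltr0n ?fact_gt0//.
  case: (i : nat) => [|k]; first by rewrite expr0 fact0 divr1 (le_trans _ (expR_ge1Dx _))// lerDl.
  by apply: le_trans (expR_ge1Dxn k (normr_ge0 x)); rewrite lerDr.
rewrite ler_wpM2l//; case: (ger0P x) => _; first by rewrite lerDl expR_ge0.
by rewrite lerDr expR_ge0.
Qed.

Lemma horner_normal_bound (q : {poly R}) :
  exists2 C, 0 <= C & forall x,
    `|q.[x] * phi x| <= C * (normal_pdf 1 1 x + normal_pdf (-1) 1 x).
Proof.
have [C C0 qC] := horner_expR_bound q.
exists (C * expR (2^-1)); first by rewrite mulr_ge0 ?expR_ge0.
move=> x; rewrite normrM (ger0_norm (normal_pdf_ge0 _ _ _)).
apply: le_trans (ler_wpM2r (normal_pdf_ge0 _ _ _) (qC x)) _.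
have := normal_pdf_shift 1 x; have := normal_pdf_shift (-1) x.
rewrite mul1r mulN1r sqrrN expr1n div1r => h1 h2.
by rewrite -!mulrA ler_wpM2l// mulrDl mulrDr h1 h2.
Qed.

Lemma normal_integrable_horner (q : {poly R}) :
  mu.-integrable setT (EFin \o (fun x => q.[x] * phi x)).
Proof.
have [C C0 qC] := horner_normal_bound q.
have mq : measurable_fun setT (fun x => q.[x] * phi x).
  apply: measurable_funM; last exact: measurable_normal_pdf.
  apply: continuous_measurable_fun; exact: continuous_horner.
apply: (@le_integrable _ _ _ mu _ measurableT _
  (fun x => (C%:E * ((normal_pdf 1 1 x)%:E + (normal_pdf (-1) 1 x)%:E))%E)).
- exact/measurable_EFinP.
- move=> x _; rewrite -EFinD -EFinM lee_fin; apply: le_trans (qC x) _.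
  exact: ler_norm.
- by apply: integrableZl => //; apply: integrableD => //; exact: integrable_normal_pdf.
Qed.

Lemma horner_normal_cvg0 (q : {poly R}) (e : R) : `|e| = 1 ->
  q.[e * n.+1%:R] * phi (e * n.+1%:R) @[n --> \oo] --> (0 : R).
Proof.
(* Bounding ['X * q] instead of [q] gains a factor [1 / (n + 1)], which is all the decay that is
   needed. *)
move=> e1; have [C C0 qC] := horner_normal_bound ('X * q).
apply/norm_cvg0P; pose K : R := C * (normal_peak 1 + normal_peak 1).
apply: (@squeeze_cvgr _ _ _ _ (cst 0) (fun n => K * n.+1%:R^-1)).
- apply: nearW => n; rewrite normr_ge0 /=.
  rewrite ler_pdivlMr//.
  have := qC (e * n.+1%:R); rewrite hornerM hornerX -mulrA normrM.
  rewrite normrM e1 mul1r normr_nat mulrC => /le_trans; apply.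
  by rewrite ler_wpM2l// lerD// normal_pdf_ub// oner_eq0.
- exact: cvg_cst.
- rewrite -[X in _ --> X](mulr0 K); apply: cvgM; first exact: cvg_cst.
  exact: cvg_harmonic.
Qed.

Lemma is_derive_normal_pdf (x : R) : is_derive x (1:R) phi (- (x * phi x)).
Proof.
have -> : phi = (fun x => normal_peak 1 * expR (- 2^-1 *: 'X^2).[x]).
  apply/funext => y; rewrite normal_pdfE ?oner_eq0// /normal_fun.
  by congr (_ * expR _); rewrite hornerZ hornerXn subr0 expr1n mulNr mulNr mulrC.
pose p : {poly R} := - 2^-1 *: 'X^2.
have d := is_deriveZ (normal_peak 1) (is_derive1_comp (is_derive_expR p.[x]) (is_derive_poly p x)).
apply: (trigger_derive d).
rewrite -[LHS]/(normal_peak 1 * (expR p.[x] * p^`().[x])).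
rewrite /p derivZ derivXn/= !hornerZ hornerXn hornerMn hornerXn expr1.
by field.
Qed.

(* Stein's identity: [('X * q - q^`()) * phi = - (q * phi)'] *)
Lemma normal_stein (q : {poly R}) :
  \int[mu]_x (('X * q - q^`()).[x] * phi x) = 0.
Proof.
set h := fun x => ('X * q - q^`()).[x] * phi x.
pose F x := - (q.[x] * phi x).
have dF x : is_derive x (1:R) F (h x).
  have d := is_deriveN (is_deriveM (is_derive_poly q x) (is_derive_normal_pdf x)).
  apply: (trigger_derive d).
  rewrite -[LHS]/(- (q.[x] * (- (x * phi x)) + phi x * q^`().[x])).
  by rewrite /h hornerD hornerN hornerM hornerX; ring.
have ih : mu.-integrable setT (EFin \o h) by exact: normal_integrable_horner.
have cM (r : {poly R}) : continuous (fun x => r.[x] * phi x).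
  move=> x; apply: (@continuousM _ _ (horner r) phi x).
    exact: continuous_horner.
  by apply: continuous_normal_pdf; rewrite oner_eq0.
have ch : continuous h by exact: cM.
have cF : continuous F by move=> x; apply: (@cvgN _ R^o); exact: cM.
(* The line is exhausted by the intervals [I n.+1], the shift keeping them nondegenerate for the
   fundamental theorem of calculus; the truncations of [h] are dominated by [|h|]. *)
pose I (n : nat) : set R := `[- n%:R, n%:R]%classic.
have FTC (n : nat) : (\int[mu]_(x in I n.+1) (h x)%:E = (F n.+1%:R - F (- n.+1%:R))%:E)%E.
  rewrite EFinB; apply: continuous_FTC2.
  - by have : (0 : R) < n.+1%:R by []; lra.
  - exact: continuous_subspaceT.
  - split => [y _||].
    + by have := dF y => -[].
    + by apply: cvg_at_right_filter; exact: cF.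
    + by apply: cvg_at_left_filter; exact: cF.
  - by move=> y _; rewrite derive1E; have := dF y => -[_].
have mh : measurable_fun setT h by exact: continuous_measurable_fun.
have mhI n : measurable_fun setT (EFin \o (h \_ (I n.+1))).
  have mI : measurable (I n.+1) by exact: measurable_itv.
  apply/measurable_EFinP; apply: (measurable_restrictT _ mI).1.
  exact: measurable_funTS.
have hIh : \forall x \ae mu, [set: R] x ->
    (EFin \o (h \_ (I n.+1))) x @[n --> \oo] --> (EFin \o h) x.
  apply: aeW => x _; apply: cvg_near_cst; near=> n => /=.
  rewrite patchE mem_set// /I/= in_itv/= -ler_norml.
  apply: (@le_trans _ _ n%:R); last by rewrite ler_nat.
  by near: n; exact: nbhs_infty_ger.
have hIle : \forall x \ae mu, forall n, [set: R] x ->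
    (`|(EFin \o (h \_ (I n.+1))) x| <= (abse \o (EFin \o h)) x)%E.
  apply: aeW => x n _; rewrite /= lee_fin patchE; case: ifP => // _.
  by rewrite normr0.
have [_ _] := @dominated_convergence _ _ _ mu setT measurableT
  (fun n => EFin \o (h \_ (I n.+1))) (EFin \o h) _ mhI
  (measurable_int _ ih) hIh (integrable_abse ih) hIle.
have -> : [sequence (\int[mu]_x (EFin \o h \_ (I n.+1)) x)%E]_n =
    (fun n : nat => (F n.+1%:R - F (- n.+1%:R))%:E).
  apply/funext => n /=; rewrite -FTC [in RHS]integral_mkcond.
  by under [in RHS]eq_integral do rewrite restrict_EFin.
have l0' : (fun n : nat => F n.+1%:R - F (- n.+1%:R)) @ \oo --> (0 : R).
  have lp := horner_normal_cvg0 q (normr1 R).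
  have ln := @horner_normal_cvg0 q (-1) (normrN1 R).
  have -> : (fun n : nat => F n.+1%:R - F (- n.+1%:R)) =
      (fun n => q.[-1 * n.+1%:R] * phi (-1 * n.+1%:R) - q.[1 * n.+1%:R] * phi (1 * n.+1%:R)).
    by apply/funext => n; rewrite /F /= mul1r mulN1r opprK addrC.
  by have := @cvgB _ R^o _ _ _ _ _ _ _ ln lp; rewrite subrr; exact.
have l0 : (F n.+1%:R - F (- n.+1%:R))%:E @[n --> \oo] --> 0%:E.
  by apply: cvg_EFin; [exact: nearW|exact: l0'].
by move=> /(cvg_unique _ l0); rewrite /Rintegral => <-.
Unshelve. all: by end_near. Qed.

End Gaussian.

Section Hermite.
Variable R : realType.

(** The probabilists' Hermite polynomials, generated by the raising operator [X - d/dX], so that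
    Stein's identity gives mean zero in positive degree at once. *)
Fixpoint hermite (r : nat) : {poly R} :=
  if r is k.+1 then 'X * hermite k - (hermite k)^`() else 1.

Lemma deriv_hermite r : (hermite r.+1)^`() = hermite r *+ r.+1.
Proof.
elim: r => [|r IH].
  by rewrite /= derivB derivM derivX derivC !(mulr0, mulr1, addr0, subr0) derivC subr0.
rewrite [hermite r.+2]/= -/(hermite r.+1) derivB derivM derivX mul1r IH derivMn.
by rewrite mulrnAr -addrA -mulrnBl [RHS]mulrS.
Qed.

(** The three-term recurrence: multiplying by the variable raises the degree (a pair is opened) or
    lowers it with multiplicity [r] (one of [r] pending copies is closed). At [r = 0] the
    coefficient cancels the default [r.-1 = 0]. *)
Lemma mulX_hermite r : 'X * hermite r = hermite r.+1 + hermite r.-1 *+ r.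
Proof.
case: r => [|r]; first by rewrite /= derivC subr0 addr0.
by rewrite [hermite r.+2]/= -/(hermite r.+1) deriv_hermite subrK.
Qed.
End Hermite.

Section NormalRV.
Context d (T : measurableType d) (R : realType) (P : probability T R).
Variable X : {RV P >-> R}.
Hypothesis normX : forall B : set R, measurable B ->
  P (X @^-1` B) = normal_prob 0 1 B.
Local Notation mu := (@lebesgue_measure R).
Local Notation phi := (normal_pdf (0:R) 1).

Lemma ge0_integral_normal_rv (f : R -> R) : measurable_fun setT f ->
  (forall t, 0 <= f t) ->
  (\int[P]_w (f (X w))%:E = \int[mu]_t (f t * phi t)%:E)%E.
Proof.
move=> mf f0.
have mfE : measurable_fun setT (EFin \o f) by exact/measurable_EFinP.
have fE0 y : (0 <= (EFin \o f) y)%E by rewrite lee_fin.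
rewrite -[LHS](ge0_integral_distribution X mfE fE0).
rewrite -[LHS]mule1; symmetry.
have mphi := measurable_normal_pdf (0 : R) 1.
have phi0 := normal_pdf_ge0 (0 : R) 1.
(* Lebesgue measure weighted by [phi] and the law of [X] agree on measurable sets, hence on
   nonnegative integrands. *)
have := @ge0_integral_weight_ext _ _ R mu (distribution P X) id phi 1%E
  (@measurable_id _ _ _) mphi phi0 lee01 isT.
apply => // B mB; rewrite mule1 [RHS]normX// /normal_prob [RHS]integral_mkcond.
apply: eq_integral => t _; rewrite patchE indicE; case: ifP => _.
  by rewrite mul1r.
by rewrite mul0r.
Qed.

Lemma integral_normal_horner (q : {poly R}) :
  P.-integrable setT (EFin \o (horner q \o X)) /\
  \int[P]_w q.[X w] = \int[mu]_t (q.[t] * phi t).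
Proof.
have mq : measurable_fun setT (horner q).
  by apply: continuous_measurable_fun; exact: continuous_horner.
have iq := normal_integrable_horner q.
split.
  apply/integrableP; split.
    by apply/measurable_EFinP; exact: measurableT_comp.
  have /integrableP[_] := iq.
  rewrite (ge0_integral_normal_rv (f := fun t => `|q.[t]|))//; last first.
    exact: measurableT_comp.
  by under eq_integral do rewrite /= normrM (ger0_norm (normal_pdf_ge0 _ _ _)).
rewrite /Rintegral; congr fine.
have mp : measurable_fun setT (horner q)^\+ by exact: measurable_funrpos.
have mn : measurable_fun setT (horner q)^\- by exact: measurable_funrneg.
rewrite [LHS]integralE [RHS]integralE; congr (_ - _)%E.
- transitivity (\int[P]_w ((horner q)^\+ (X w))%:E)%E.
    by apply: eq_integral => w _; rewrite funeposE -EFin_max.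
  rewrite (ge0_integral_normal_rv mp)//.
  apply: eq_integral => t _; rewrite funeposE -EFin_max /funrpos maxr_pMl ?normal_pdf_ge0//.
  by rewrite mul0r.
- transitivity (\int[P]_w ((horner q)^\- (X w))%:E)%E.
    by apply: eq_integral => w _; rewrite funenegE -EFinN -EFin_max.
  rewrite (ge0_integral_normal_rv mn)//.
  apply: eq_integral => t _; rewrite funenegE -EFinN -EFin_max /funrneg maxr_pMl ?normal_pdf_ge0//.
  by rewrite mul0r mulNr.
Qed.

Lemma expectation_hermite r : \int[P]_w (hermite R r).[X w] = (r == 0%N)%:R.
Proof.
case: r => [|r].
  rewrite /=; under eq_Rintegral do rewrite hornerC.
  rewrite Rintegral_cst//. transitivity (1 * fine (P setT)) => //.
  by rewrite (probability_setT P) mul1r.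
by rewrite (integral_normal_horner _).2 normal_stein.
Qed.

Lemma expectation_expR_normal (s : R) :
  (\int[P]_w (expR (s * X w))%:E = (expR (s ^+ 2 / 2))%:E)%E.
Proof.
have me : measurable_fun setT (fun t : R => expR (s * t)).
  by apply: measurableT_comp => //; exact: measurable_funM.
rewrite (ge0_integral_normal_rv me); last by move=> t; exact: expR_ge0.
under eq_integral do rewrite normal_pdf_shift EFinM.
rewrite ge0_integralZl_EFin ?expR_ge0//; first by rewrite integral_normal_pdf mule1.
- by move=> t _; rewrite lee_fin normal_pdf_ge0.
- by apply/measurable_EFinP; exact: measurable_normal_pdf.
Qed.
End NormalRV.

(** * Walks and trace moments *)

Section WickCoefficients.
Variables (R : realType) (D : R).

(** Power series coefficients of [exp (D z^2 / 2)]: [j! * wick_coef j] is the [j]-th moment of a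
    centred Gaussian of variance [D]. *)
Definition wick_coef (j : nat) : R :=
  if odd j then 0 else (D / 2) ^+ j./2 / (j./2)`!%:R.

(** Coefficient form of the differential equation [f' = D z f] satisfied by
    [f = exp (D z^2 / 2)]. *)
Lemma wick_coef_rec j : j.+2%:R * wick_coef j.+2 = D * wick_coef j.
Proof.
rewrite /wick_coef /= negbK; case: ifPn => oj; first by rewrite !mulr0.
rewrite exprS factS natrM.
have -> : j.+2%:R = 2 * (j./2).+1%:R :> R.
  by rewrite -natrM mul2n doubleS even_halfK.
have f0 : (j./2)`!%:R != 0 :> R by rewrite pnatr_eq0 -lt0n fact_gt0.
have s0 : (j./2).+1%:R != 0 :> R by rewrite pnatr_eq0.
move: ((D / 2) ^+ _) ((j./2)`!%:R) ((j./2).+1%:R) f0 s0 => x f s f0 s0.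
by field; rewrite s0 f0.
Qed.

(* [D ^ ((k - r) / 2)] times the number of ways to match [r] pending labels with
   distinct steps among [k] and to pair up the remaining [k - r] steps. *)
Definition wick_bound (k r : nat) : R :=
  if (r <= k)%N then k`!%:R * wick_coef (k - r) else 0.

(** Condition on the first of [k + 1] steps: either it is paired with a later step, in [D] ways, and
    becomes pending, or it closes one of the [r] pending labels. *)
Lemma wick_bound_rec k r :
  D * wick_bound k r.+1 + r%:R * wick_bound k r.-1 = wick_bound k.+1 r.
Proof.
rewrite /wick_bound; have [rk|rk|->] := ltngtP r k.
- have -> : (r.-1 <= k)%N by lia.
  have -> : (r <= k.+1)%N by lia.
  case: r rk => [|r] rk.
    rewrite mul0r addr0 !subn0 factS natrM mulrCA -wick_coef_rec.
    have -> : ((k - 1).+2 = k.+1)%N by lia.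
    by rewrite mulrA [k`!%:R * _]mulrC.
  have E1 : (k.+1 - r.+1 = (k - r.+2).+2)%N by lia.
  have E2 : (k - r = (k - r.+2).+2)%N by lia.
  rewrite /= E1 E2 mulrCA -wick_coef_rec factS natrM.
  have -> : k.+1%:R = (k - r.+2).+2%:R + r.+1%:R :> R.
    by rewrite -natrD; congr (_%:R); lia.
  ring.
- case: r rk => [//|r] rk /=; rewrite mulr0 add0r.
  have [rk'|rk'] := leqP r k; last by rewrite ltnS leqNgt rk' mulr0.
  have -> : r = k by lia.
  by rewrite leqnn !subnn factS natrM mulrA.
(* Exactly one step remains unmatched, so both sides vanish by parity. *)
- rewrite mulr0 add0r leqnSn subSnn; case: k => [|k]; first by rewrite mul0r /wick_coef/= mulr0.
  by rewrite /= leqnSn subSnn /wick_coef/= !mulr0.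
Qed.

Lemma wick_bound_ge0 k r : 0 <= D -> 0 <= wick_bound k r.
Proof.
move=> D0; rewrite /wick_bound /wick_coef; case: ifP => // _; apply: mulr_ge0 => //.
by case: ifP => // _; rewrite divr_ge0// exprn_ge0// divr_ge0.
Qed.

Lemma wick_bound_even k : wick_bound (2 * k) 0 = (2 * k)`!%:R * ((D / 2) ^+ k / k`!%:R).
Proof. by rewrite /wick_bound /wick_coef /= subn0 mul2n odd_double doubleK. Qed.
End WickCoefficients.

Section HermiteProducts.
Context d (T : measurableType d) (R : realType) (P : probability T R).
Variables (L : finType) (G : L -> {RV P >-> R}).
Hypothesis normG : forall e (B : set R), measurable B ->
  P (G e @^-1` B) = normal_prob 0 1 B.
Hypothesis indG : mutually_independent G.

Definition herm_prod (a : L -> nat) (w : T) : R := \prod_e (hermite R (a e)).[G e w].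

Lemma expectation_herm_prod a :
  P.-integrable setT (EFin \o herm_prod a) /\
  \int[P]_w herm_prod a w = (\sum_e a e == 0)%N%:R.
Proof.
have mh e : measurable_fun setT (horner (hermite R (a e))).
  by apply: continuous_measurable_fun; exact: continuous_horner.
have [I1 I2] := indep_integral indG mh
  (fun e => (integral_normal_horner (normG e) (hermite R (a e))).1).
split=> //; rewrite [LHS]I2.
rewrite (eq_bigr (fun e => (a e == 0)%N%:R)); last first.
  by move=> e _; exact: (expectation_hermite (X := G e) (normG e)).
have [/forallP a0|] := boolP [forall e, a e == 0%N].
  by rewrite !big1// => e _; rewrite (eqP (a0 e)).
rewrite negb_forall => /existsP[e ae].
rewrite (bigD1 e)//= (negbTE ae) mul0r.
by rewrite [in RHS](bigD1 e)//= addn_eq0 (negbTE ae).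
Qed.

Definition incr (a : L -> nat) (e : L) : L -> nat := fun e' => (a e' + (e' == e))%N.
Definition decr (a : L -> nat) (e : L) : L -> nat := fun e' => (a e' - (e' == e))%N.

(** Only the factor at [e] changes, by the three-term recurrence. The truncated subtraction in
    [decr] is harmless, since its term carries the coefficient [a e]. *)
Lemma mul_herm_prod a e w :
  G e w * herm_prod a w =
  herm_prod (incr a e) w + (a e)%:R * herm_prod (decr a e) w.
Proof.
have prodD1 (f : L -> R) : \prod_i f i = f e * \prod_(i | i != e) f i.
  exact: bigD1.
rewrite /herm_prod !prodD1 /incr /decr eqxx addn1 subn1.
rewrite [X in _ = _ * X + _](eq_bigr (fun i => (hermite R (a i)).[G i w])); last first.
  by move=> i /negbTE ->; rewrite addn0.
rewrite [X in _ = _ + _ * (_ * X)](eq_bigr (fun i => (hermite R (a i)).[G i w])); last first.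
  by move=> i /negbTE ->; rewrite subn0.
rewrite !mulrA -mulrDl; congr (_ * _).
have := congr1 (horner^~ (G e w)) (mulX_hermite R (a e)).
by rewrite hornerM hornerX hornerD hornerMn mulr_natl.
Qed.

Lemma sum_incr a e : (\sum_e' incr a e e' = (\sum_e' a e').+1)%N.
Proof.
rewrite big_split /= [X in (_ + X)%N](bigD1 e)//= eqxx.
rewrite [X in (_ + (_ + X))%N]big1 ?addn0 ?addn1//.
by move=> i /negbTE ->.
Qed.

Lemma sum_decr a e : (0 < a e)%N -> (\sum_e' decr a e e' = (\sum_e' a e').-1)%N.
Proof.
move=> ae; rewrite (bigD1 e)//= [in RHS](bigD1 e)//= {1}/decr eqxx.
rewrite (eq_bigr a) => [|i /negbTE ie]; first by lia.
by rewrite /decr ie subn0.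
Qed.
End HermiteProducts.

Lemma Rintegral_sum d (T : measurableType d) (R : realType)
    (mu : {measure set T -> \bar R}) (I : Type) (s : seq I) (f : I -> T -> R) :
  (forall i, mu.-integrable setT (EFin \o f i)) ->
  mu.-integrable setT (EFin \o (fun w => \sum_(i <- s) f i w)) /\
  \int[mu]_w (\sum_(i <- s) f i w) = \sum_(i <- s) \int[mu]_w f i w.
Proof.
move=> fI; elim: s => [|i s [IH1 IH2]].
  split.
    have -> : EFin \o (fun w => \sum_(i <- [::]) f i w) = cst 0%E.
      by apply/funext => w; rewrite /= big_nil.
    exact: integrable0.
  under eq_Rintegral do rewrite big_nil.
  by rewrite big_nil /Rintegral integral0.
split.
  have -> : EFin \o (fun w => \sum_(j <- i :: s) f j w) =
      (EFin \o f i) \+ (EFin \o (fun w => \sum_(j <- s) f j w)).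
    by apply/funext => w; rewrite /= big_cons.
  exact: (integrableD measurableT (fI i) IH1).
under eq_Rintegral do rewrite big_cons.
by rewrite RintegralD// IH2 big_cons.
Qed.

Section WalkMoments.
Context d (T : measurableType d) (R : realType) (P : probability T R).
Variables (L : finType) (G : L -> {RV P >-> R}).
Hypothesis normG : forall e (B : set R), measurable B ->
  P (G e @^-1` B) = normal_prob 0 1 B.
Hypothesis indG : mutually_independent G.
Variables (m D : nat) (lab : 'I_m -> 'I_m -> option L).
Hypothesis lab_inj : forall i j j' e,
  lab i j = Some e -> lab i j' = Some e -> j = j'.
Hypothesis lab_deg : forall i, (#|[pred j | lab i j]| <= D)%N.

Definition labelled_mx (w : T) : 'M[R]_m :=
  \matrix_(i, j) oapp (fun e => G e w) 0 (lab i j).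

(** From [i], at most one step carries a given label, so each pending label is counted at most
    once. *)
Lemma sum_label_le (a : L -> nat) i :
  (\sum_j oapp a 0 (lab i j) <= \sum_e a e)%N.
Proof.
rewrite (eq_bigr (fun j => \sum_(e | lab i j == Some e) a e)%N); last first.
  move=> j _; case: (lab i j) => [e|] /=; last by rewrite big_pred0.
  by rewrite (big_pred1 e) // => e'; rewrite /= eq_sym.
rewrite (exchange_big_dep predT)//=; apply: leq_sum => e _.
have [/existsP[j /eqP je]|/existsPn h] := boolP [exists j, lab i j == Some e].
  rewrite (big_pred1 j) // => j' /=; apply/eqP/eqP => [/lab_inj|->//].
  by apply; exact: je.
by rewrite big_pred0// => j; apply/negbTE.
Qed.

(* The weight [herm_prod a] records the labels already used by the walk and
   still waiting to be paired with a later step: a step either opens a new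
   pair ([incr]) or closes a pending one ([decr]). *)
Lemma walk_moment k i j (a : L -> nat) :
  P.-integrable setT
    (EFin \o (fun w => (labelled_mx w ^+ k) i j * herm_prod G a w)) /\
  \int[P]_w ((labelled_mx w ^+ k) i j * herm_prod G a w) <=
    wick_bound D%:R k (\sum_e a e).
Proof.
elim: k i j a => [|k IH] i j a.
  have [I1 I2] := expectation_herm_prod normG indG a.
  have -> : (fun w => (labelled_mx w ^+ 0) i j * herm_prod G a w) =
      (fun w => (i == j)%:R * herm_prod G a w).
    by apply/funext => w; rewrite expr0 mxE.
  split.
    exact: (integrableZl measurableT (i == j)%:R I1).
  rewrite RintegralZl// I2 /wick_bound leqn0; case: ifP => [/eqP ->|]; last by rewrite mulr0.
  (* The constraint that the walk ends at [j] is relaxed here, its indicator being at most 1. *)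
  by rewrite /wick_coef/= expr0 divr1 mulr1 mulr1; case: eqP.
pose term l w := if lab i l is Some e then
  (labelled_mx w ^+ k) l j * herm_prod G (incr a e) w +
  (a e)%:R * ((labelled_mx w ^+ k) l j * herm_prod G (decr a e) w) else 0.
have -> : (fun w => (labelled_mx w ^+ k.+1) i j * herm_prod G a w) =
    (fun w => \sum_l term l w).
  apply/funext => w; rewrite exprS -mulmxE mxE mulr_suml; apply: eq_bigr => l _.
  rewrite /term {1}mxE; case: (lab i l) => [e|] /=; last by rewrite !mul0r.
  by rewrite mulrAC mul_herm_prod; ring.
have itermZ l e : P.-integrable setT (EFin \o (fun w => (a e)%:R *
    ((labelled_mx w ^+ k) l j * herm_prod G (decr a e) w))).
  exact: (integrableZl measurableT (a e)%:R (IH l j _).1).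
have iterm l : P.-integrable setT (EFin \o term l).
  rewrite /term; case: (lab i l) => [e|]; last exact: integrable0.
  exact: (integrableD measurableT (IH l j _).1 (itermZ l e)).
have [Isum ->] := Rintegral_sum (index_enum _) iterm.
split=> //; set r := (\sum_e a e)%N.
have D0 : (0 : R) <= D%:R by [].
(* The first sum collects the opening steps, at most [D] of them; the second the closing steps, each
   weighted by the number [a e] of pending copies of its label. *)
apply: (@le_trans _ _ (\sum_(l | lab i l) wick_bound D%:R k r.+1 +
    (\sum_l oapp a 0 (lab i l))%:R * wick_bound D%:R k r.-1)).
  rewrite natr_sum mulr_suml [X in _ <= X + _]big_mkcond -big_split /=.
  apply: ler_sum => l _; rewrite /term; case: (lab i l) => [e|] /=; last first.
    by rewrite Rintegral_cst// mul0r mul0r addr0.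
  rewrite RintegralD//; last exact: (IH l j _).1.
  rewrite RintegralZl//; last exact: (IH l j _).1.
  apply: lerD; first by rewrite -(sum_incr a e); exact: (IH l j _).2.
  have [->|a0] := posnP (a e); first by rewrite !mul0r.
  by rewrite ler_wpM2l// -(sum_decr a0); exact: (IH l j _).2.
rewrite -wick_bound_rec; apply: lerD.
  rewrite sumr_const -[leLHS]mulr_natl ler_wpM2r ?wick_bound_ge0// ler_nat.
  exact: lab_deg.
by rewrite ler_wpM2r ?wick_bound_ge0// ler_nat sum_label_le.
Qed.

Lemma trace_moment k :
  P.-integrable setT (EFin \o (fun w => \tr (labelled_mx w ^+ (2 * k)))) /\
  \int[P]_w \tr (labelled_mx w ^+ (2 * k)) <=
    m%:R * ((2 * k)`!%:R * ((D%:R / 2) ^+ k / k`!%:R)).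
Proof.
have -> : (fun w => \tr (labelled_mx w ^+ (2 * k))) = (fun w => \sum_i
    ((labelled_mx w ^+ (2 * k)) i i * herm_prod G (fun=> 0%N) w)).
  apply/funext => w; apply: eq_bigr => i _; rewrite /herm_prod big1 ?mulr1// => e _.
  by rewrite hornerC.
have [Isum ->] := Rintegral_sum (index_enum _) (fun i => (walk_moment (2 * k) i i (fun=> 0%N)).1).
split=> //; apply: (@le_trans _ _ (\sum_(i < m) wick_bound D%:R (2 * k) 0)).
  apply: ler_sum => i _; have := (walk_moment (2 * k) i i (fun=> 0%N)).2.
  by rewrite big1.
by rewrite sumr_const card_ord wick_bound_even -[leLHS]mulr_natl.
Qed.

Hypothesis lab_sym : forall i j, lab i j = lab j i.
Hypothesis m_gt0 : (0 < m)%N.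

Lemma tr_labelled_mx w : (labelled_mx w)^T = labelled_mx w.
Proof. by apply/matrixP => i j; rewrite !mxE lab_sym. Qed.

(** Markov's inequality, with the trace as majorant: on the event it is at least [t ^+ (2 * k)], and
    elsewhere it is nonnegative as a squared Frobenius norm. *)
Lemma lambda_max_moment t k : 0 <= t ->
  d.-measurable [set w | t <= lambda_max (labelled_mx w)] ->
  fine (P [set w | t <= lambda_max (labelled_mx w)]) * t ^+ (2 * k) <=
    m%:R * ((2 * k)`!%:R * ((D%:R / 2) ^+ k / k`!%:R)).
Proof.
move=> t0; set A := [set w | _] => mA; have [It] := trace_moment k.
apply: le_trans.
have IA : P.-integrable setT (EFin \o (\1_A : T -> R)).
  exact: integrable_indic.
have -> : fine (P A) = \int[P]_w \1_A w.
  by rewrite /Rintegral integral_indic// setIT.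
rewrite -RintegralZr//; apply: le_Rintegral => //.
  exact: (integrableZr measurableT (t ^+ (2 * k)) IA).
move=> w _; rewrite indicE; case: (boolP (w \in A)) => [|_].
  rewrite inE /A/= => tw; rewrite mul1r.
  by apply: lambda_max_pow_le_trace => //; exact: tr_labelled_mx.
rewrite mul0r mxtrace_symX2; last exact: tr_labelled_mx.
by apply: sumr_ge0 => l _; exact: dot_ge0.
Qed.
End WalkMoments.

(** * From moment bounds to an exponential tail *)

Section Tail.
Variable R : realType.

Lemma exp_coeff_sum_le (x : R) n : 0 <= x ->
  \sum_(0 <= k < n) x ^+ k / k`!%:R <= expR x.
Proof.
move=> x0; apply: (@nondecreasing_cvgn_le R (series (exp_coeff x))).
  by apply: nondecreasing_series => k _ _; rewrite divr_ge0// exprn_ge0.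
exact: is_cvg_series_exp_coeff.
Qed.

Lemma cosh_series_bound (a c s : R) : 0 <= a -> 0 <= c -> 0 <= s ->
  (forall k, a * (s ^+ (2 * k) / (2 * k)`!%:R) <= c * ((s / 2) ^+ k / k`!%:R)) ->
  a * expR s <= 2 * c * expR (s / 2).
Proof.
move=> a0 c0 s0 H.
(* Series coefficients of [2 cosh s]: the odd ones cancel and the even ones match the hypothesis. *)
pose g k := (s ^+ k + (- s) ^+ k) / k`!%:R.
have g_even k : g (k.*2) = 2 * (s ^+ (2 * k) / (2 * k)`!%:R).
  by rewrite /g -mul2n !exprM sqrrN mulrDl [RHS]mulr_natl.
have g_odd k : g (k.*2.+1) = 0.
  by rewrite /g -mul2n !exprS !exprM sqrrN mulNr subrr mul0r.
have g_ge0 i : 0 <= g i.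
  rewrite -(odd_double_half i); case: (odd i); first by rewrite add1n g_odd.
  by rewrite add0n g_even mulr_ge0// divr_ge0// exprn_ge0.
have g_sum n : \sum_(0 <= i < n.*2) g i = \sum_(0 <= k < n) g k.*2.
  elim: n => [|n IH]; first by rewrite !big_nil.
  by rewrite doubleS !big_nat_recr//= IH g_odd addr0.
(* All terms are nonnegative, so the partial sum may be extended to length [n.*2], where it splits
   into [n] even terms. *)
have bound n : a * \sum_(0 <= i < n) g i <= 2 * c * expR (s / 2).
  apply: (@le_trans _ _ (a * \sum_(0 <= i < n.*2) g i)).
    rewrite ler_wpM2l// -addnn (@big_cat_nat _ _ _ n _ (n + n))//= ?leq_addr//.
    by rewrite lerDl sumr_ge0.
  rewrite g_sum mulr_sumr -[leRHS]mulrA.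
  apply: (@le_trans _ _ (\sum_(0 <= k < n) 2 * (c * ((s / 2) ^+ k / k`!%:R)))).
    by apply: ler_sum => k _; rewrite g_even mulrCA ler_wpM2l.
  rewrite -mulr_sumr ler_wpM2l// -mulr_sumr ler_wpM2l//.
  by apply: exp_coeff_sum_le; rewrite divr_ge0.
apply: (@le_trans _ _ (a * (expR s + expR (- s)))).
  by rewrite ler_wpM2l// lerDl expR_ge0.
have cv : a * \sum_(0 <= i < n) g i @[n --> \oo] --> a * (expR s + expR (- s)).
  apply: cvgM; first exact: cvg_cst.
  have -> : (fun n => \sum_(0 <= i < n) g i) =
      (fun n => series (exp_coeff s) n + series (exp_coeff (- s)) n).
    apply/funext => n; rewrite /series/= -big_split /=.
    by apply: eq_bigr => i _; rewrite /g mulrDl.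
  by apply: (@cvgD _ R^o); exact: is_cvg_series_exp_coeff.
by apply: (cvgr_to_le cv); exact: nearW.
Qed.
End Tail.

Section NullTail.
Context d (T : measurableType d) (R : realType) (P : probability T R).
Variables (L : finType) (G : L -> {RV P >-> R}).
Hypothesis normG : forall e (B : set R), measurable B ->
  P (G e @^-1` B) = normal_prob 0 1 B.
Hypothesis indG : mutually_independent G.
Variables (m D : nat) (lab : 'I_m -> 'I_m -> option L).
Hypothesis lab_inj : forall i j j' e,
  lab i j = Some e -> lab i j' = Some e -> j = j'.
Hypothesis lab_deg : forall i, (#|[pred j | lab i j]| <= D)%N.
Hypothesis lab_sym : forall i j, lab i j = lab j i.
Hypothesis m_gt0 : (0 < m)%N.
Hypothesis D_gt0 : (0 < D)%N.

Lemma lambda_max_tail (lam : R) : 0 <= lam ->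
  d.-measurable [set w | lam * D%:R / 2 <= lambda_max (labelled_mx G lab w)] ->
  (P [set w | (lam * D%:R / 2 <= lambda_max (labelled_mx G lab w))%R] <=
    (2 * m%:R * expR (- (lam ^+ 2 * D%:R / 8)))%:E)%E.
Proof.
move=> lam0 mA; set A := [set w | _] in mA *.
have D0 : (0 : R) < D%:R by rewrite ltr0n.
have PA : P A = (fine (P A))%:E by rewrite fineK// fin_num_measure.
(* With threshold [t = lam * D / 2], this is [s = t^2 / D], which minimises the resulting exponent:
   [s / 2 - s = - lam^2 * D / 8]. *)
rewrite PA lee_fin; set s := lam ^+ 2 * D%:R / 4.
have s0 : 0 <= s by rewrite divr_ge0// mulr_ge0// ?sqr_ge0.
have -> : - (lam ^+ 2 * D%:R / 8) = s / 2 - s by rewrite /s; field.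
rewrite expRB mulrA ler_pdivlMr ?expR_gt0//.
apply: cosh_series_bound => // [|k]; first exact: fine_ge0.
have := lambda_max_moment normG indG lab_inj lab_deg lab_sym m_gt0 k _ mA.
rewrite -/A; set t := lam * D%:R / 2.
have -> : t ^+ (2 * k) = s ^+ k * D%:R ^+ k.
  by rewrite exprM -exprMn; congr (_ ^+ _); rewrite /t /s; field.
have -> : (D%:R / 2) ^+ k = 2^-1 ^+ k * D%:R ^+ k :> R by rewrite mulrC exprMn.
have Dk : 0 < D%:R ^+ k :> R by rewrite exprn_gt0.
have f0 : 0 < (2 * k)`!%:R :> R by rewrite ltr0n fact_gt0.
have t0 : 0 <= t by rewrite divr_ge0// mulr_ge0// ltW.
move=> /(_ t0).
have -> : m%:R * ((2 * k)`!%:R * (2^-1 ^+ k * D%:R ^+ k / k`!%:R)) =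
  (m%:R * (2 * k)`!%:R * (2^-1 ^+ k / k`!%:R)) * D%:R ^+ k :> R by ring.
rewrite [leLHS]mulrA ler_pM2r// => h.
rewrite [leLHS]mulrA ler_pdivrMr// exprM exprAC expr2 [(s / 2) ^+ k]exprMn.
have := ler_wpM2r (exprn_ge0 k s0) h.
by congr (_ <= _); ring.
Qed.
End NullTail.

(** * The spiked law *)

Section SpikedChernoff.
Context d (T : measurableType d) (R : realType) (P : probability T R).
Variables (L K : finType) (G : L -> {RV P >-> R}) (x : K -> {RV P >-> R}).
Hypothesis normG : forall e (B : set R), measurable B ->
  P (G e @^-1` B) = normal_prob 0 1 B.
Hypothesis radx : forall i, P (x i @^-1` [set 1]) = (2^-1)%:E /\
  P (x i @^-1` [set -1]) = (2^-1)%:E.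
Hypothesis indGx : mutually_independent
  (fun k : (L + K)%type => match k with inl e => G e | inr i => x i end).

Definition sign (b : bool) : R := if b then 1 else -1.

Lemma prob_sign i b : P (x i @^-1` [set sign b]) = (2^-1)%:E.
Proof. by rewrite /sign; case: b; have [] := radx i. Qed.

(** The two atoms already carry total mass 1, whereas nothing confines [x i] to them pointwise. *)
Lemma prob_not_sign i : P (x i @^-1` ~` [set 1; -1]) = 0%E.
Proof.
have m1 (r : R) : measurable (x i @^-1` [set r]).
  by rewrite -[X in measurable X]setTI; exact: measurable_funP.
rewrite -preimage_setC probability_setC; last first.
  by rewrite preimage_setU; exact: measurableU.
rewrite preimage_setU measureU//; last first.
  apply/seteqP; split => // w [/= -> /eqP].
  by rewrite -subr_eq0 opprK -mulr2n pnatr_eq0.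
have [r1 r2] := radx i.
rewrite [X in (_ - X)%E](_ : _ = (2^-1 + 2^-1)%:E); last first.
  by rewrite EFinD; congr (_ + _)%E; [exact: r1|exact: r2].
by rewrite -EFinB; congr EFin; field.
Qed.

(** Conditioning on [x] is replaced by a sum over its sign patterns [s]. Each pattern contributes
    the Chernoff bound for its own coefficients [b s] times its probability [2^-|K|], and the
    [2^|K|] patterns make these factors cancel. *)
Lemma spiked_chernoff (b : {ffun K -> bool} -> L -> R) (v a th : R) (A : set T) :
  measurable A -> 0 <= th -> (forall s, \sum_e b s e ^+ 2 <= v) ->
  (forall w (s : {ffun K -> bool}), A w -> (forall i, x i w = sign (s i)) ->
    \sum_e b s e * G e w <= - a) ->
  (P A <= (expR (th ^+ 2 * v / 2 - th * a))%:E)%E.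
Proof.
move=> mA th0 bv bA.
pose f s (k : (L + K)%type) : R -> R := match k with
  | inl e => fun t => expR (- (th * b s e) * t)
  | inr i => \1_[set sign (s i)] end.
pose X (k : (L + K)%type) := match k with inl e => G e | inr i => x i end.
have f0 s k t : 0 <= f s k t by case: k => [e|i] //=; exact: expR_ge0.
have mf s k : measurable_fun setT (f s k).
  case: k => [e|i] /=; last exact: measurable_indic.
  by apply: measurableT_comp => //; exact: measurable_funM.
have intf s k : (\int[P]_w (f s k (X k w))%:E = match k with
    inl e => (expR ((- (th * b s e)) ^+ 2 / 2))%:E | inr _ => (2^-1)%:E end)%E.
  case: k => [e|i] /=; first exact: (expectation_expR_normal (normG e)).
  by rewrite integral_indic_rv// prob_sign.
have intprod s : (\int[P]_w (\prod_k f s k (X k w))%:E <=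
    (expR (th ^+ 2 * v / 2) * 2^-1 ^+ #|K|)%:E)%E.
  rewrite (indep_ge0_integral indGx)//; last first.
    by move=> k; rewrite intf; case: k => *; exact: ltry.
  under eq_bigr do rewrite intf.
  rewrite big_sumType /= !prodEFin -EFinM lee_fin prodr_const.
  rewrite ler_wpM2r ?exprn_ge0 ?invr_ge0// -expR_sum ler_expR.
  rewrite -mulr_suml ler_wpM2r ?invr_ge0//.
  under eq_bigr do rewrite sqrrN exprMn.
  by rewrite -mulr_sumr ler_wpM2l ?sqr_ge0.
pose N i : set T := x i @^-1` ~` [set 1; -1].
have mN i : measurable (N i).
  rewrite -[X in measurable X]setTI; apply: measurable_funP => //.
  by apply: measurableC; exact: measurableU.
(* A majorant of the indicator of [A]: the exponential tilt for the pattern realised by [x], plus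
   indicators of null events where some [x i] is not a sign. *)
pose F w : R := \sum_s (expR (- (th * a)) * \prod_k f s k (X k w)) + \sum_i \1_(N i) w.
have t0 s w : 0 <= expR (- (th * a)) * \prod_k f s k (X k w).
  by rewrite mulr_ge0 ?expR_ge0 ?prodr_ge0.
have n0 w : 0 <= \sum_i \1_(N i) w :> R by apply: sumr_ge0.
have s0 w : 0 <= \sum_s expR (- (th * a)) * \prod_k f s k (X k w).
  exact: sumr_ge0.
have AF w : \1_A w <= F w.
  rewrite indicE; case: (boolP (w \in A)) => [|_]; last by rewrite addr_ge0.
  rewrite inE => Aw.
  have [/forallP xs|] := boolP [forall i, x i w \in [set 1; -1]]; last first.
    rewrite negb_forall => /existsP[i xi].
    apply: ler_wpDl => //; rewrite (bigD1 i)//= indicE mem_set ?lerDl ?sumr_ge0//.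
    by move: xi; rewrite notin_setE.
  pose s : {ffun K -> bool} := [ffun i => x i w == 1].
  have xE i : x i w = sign (s i).
    have := xs i; rewrite inE /= ffunE => -[->|->]; first by rewrite eqxx.
    by rewrite /sign -subr_eq0 -opprD oppr_eq0 -mulr2n pnatr_eq0.
  apply: ler_wpDr => //; rewrite (bigD1 s)//=; apply: ler_wpDr; first exact: sumr_ge0.
  rewrite big_sumType /= [X in _ * (_ * X)]big1 ?mulr1; last first.
    by move=> i _; rewrite indicE mem_set//= xE.
  rewrite -expR_sum -expRD -expR0 ler_expR.
  under eq_bigr do rewrite mulNr -mulrA.
  rewrite sumrN -mulr_sumr -opprD oppr_ge0 -mulrDr mulr_ge0_le0//.
  by have := bA w s Aw xE; lra.
have mprod s : measurable_fun setT (fun w => \prod_k f s k (X k w)).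
  by apply: measurable_prod => k _; exact: measurableT_comp.
have mterm s : measurable_fun setT
    (fun w => expR (- (th * a)) * \prod_k f s k (X k w)).
  exact: measurable_funM.
have mnot i : measurable_fun setT (\1_(N i) : T -> R) by exact: measurable_indic.
have mA1 : measurable_fun setT (\1_A : T -> R) by exact: measurable_indic.
rewrite -[A]setIT -integral_indic//.
apply: (@le_trans _ _ (\int[P]_w (F w)%:E)%E).
  apply: ge0_le_integral => //.
  - by apply/measurable_EFinP.
  - apply/measurable_EFinP; apply: measurable_funD; exact: measurable_sum.
  - by move=> w _; rewrite lee_fin.
under eq_integral do rewrite EFinD.
rewrite ge0_integralD//; last first.
- by apply/measurable_EFinP; exact: measurable_sum.
- by move=> w _; rewrite lee_fin.
- by apply/measurable_EFinP; exact: measurable_sum.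
- by move=> w _; rewrite lee_fin.
under eq_integral do rewrite -sumEFin.
under [X in (_ + X)%E]eq_integral do rewrite -sumEFin.
rewrite !ge0_integral_sum//; last first.
- by move=> s w _; rewrite lee_fin.
- by move=> s; apply/measurable_EFinP.
- by move=> i; apply/measurable_EFinP.
rewrite [X in (_ + X)%E]big1 ?adde0; last first.
  by move=> i _; rewrite integral_indic// setIT; exact: prob_not_sign.
apply: (@le_trans _ _ (\sum_(s : {ffun K -> bool})
    (expR (- (th * a)) * (expR (th ^+ 2 * v / 2) * 2^-1 ^+ #|K|))%:E)%E).
  apply: lee_sum => s _; under eq_integral do rewrite EFinM.
  rewrite ge0_integralZl_EFin ?expR_ge0//; last first.
  - by apply/measurable_EFinP.
  - by move=> w _; rewrite lee_fin prodr_ge0.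
  by rewrite EFinM lee_wpmul2l ?lee_fin ?expR_ge0.
rewrite sumEFin lee_fin sumr_const -[leLHS]mulr_natl card_ffun card_bool natrX.
rewrite mulrCA [X in _ * X]mulrCA exprVn divff ?expf_neq0//.
by rewrite mulr1 -expRD addrC.
Qed.
End SpikedChernoff.

(** * The symmetric difference matrix *)

Section SymmetricDifference.
Variable n : nat.
Implicit Types S T E : {set 'I_n}.

Lemma symdiffC S T : symdiff S T = symdiff T S.
Proof. by rewrite /symdiff finset.setUC. Qed.

Lemma symdiffK S : involutive (symdiff S).
Proof.
by move=> T; apply/finset.setP => i; rewrite !inE; case: (i \in S); case: (i \in T).
Qed.

Lemma card_ksets k : #|{: ksets n k}| = 'C(n, k).
Proof.
rewrite card_sig -[in RHS](card_ord n) -card_draws.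
by apply: eq_card => E; rewrite !inE.
Qed.

(** For sets of equal size, the two halves of the symmetric difference have the same cardinality;
    hence only even sizes occur. *)
Lemma card_symdiff_eq S T h : #|S| = #|T| ->
  (#|symdiff S T| == h.*2) = (#|S :\: T| == h) && (#|T :\: S| == h).
Proof.
move=> ST; rewrite /symdiff cardsU.
have -> : (S :\: T) :&: (T :\: S) = finset.set0.
  by apply/finset.setP => i; rewrite !inE; case: (i \in S); case: (i \in T).
have := cardsID T S; have := cardsID S T; rewrite finset.setIC cards0 subn0.
by move=> h1 h2; apply/idP/idP => [/eqP|/andP[/eqP-> /eqP->]]; lia.
Qed.

(** A neighbour of [S] arises in a unique way by removing [h] elements of [S] and adding [h]
    elements outside it. *)
Lemma card_symdiff_nbrs l h S : #|S| = l ->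
  #|[set T : {set 'I_n} | (#|T| == l) && (#|symdiff S T| == h.*2)]%SET| =
  ('C(n - l, h) * 'C(l, h))%N.
Proof.
move=> Sl; pose X := finset.setX [set A : {set 'I_n} | A \subset S & #|A| == h]
  [set B : {set 'I_n} | B \subset ~: S & #|B| == h].
pose f (AB : {set 'I_n} * {set 'I_n}) := (S :\: AB.1) :|: AB.2.
have fP (A B : {set 'I_n}) : A \subset S -> B \subset ~: S ->
    S :\: f (A, B) = A /\ f (A, B) :\: S = B.
  move=> /fintype.subsetP AS /fintype.subsetP BS; split; apply/finset.setP => i; rewrite !inE /=.
    by have := AS i; have := BS i; rewrite inE; case: (i \in A); case: (i \in B); case: (i \in S) => // h1 h2; by [have := h1 isT | have := h2 isT].
  by have := AS i; have := BS i; rewrite inE; case: (i \in A); case: (i \in B); case: (i \in S) => // h1 h2; by [have := h1 isT | have := h2 isT].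
have -> : [set T : {set 'I_n} | (#|T| == l) && (#|symdiff S T| == h.*2)]%SET = f @: X.
  apply/finset.setP => T; rewrite inE; apply/andP/imsetP => [[/eqP Tl]|].
    rewrite card_symdiff_eq ?Sl ?Tl// => /andP[h1 h2].
    exists (S :\: T, T :\: S); first by rewrite !inE h1 h2 finset.subsetDl /= finset.subsetDr.
    by apply/finset.setP => i; rewrite !inE /=; case: (i \in S); case: (i \in T).
  case=> -[A B]; rewrite !inE /= => /andP[/andP[AS Ah] /andP[BS Bh]] ->.
  have [E1 E2] := fP A B AS BS.
  have Tl : #|f (A, B)| = #|S|.
    have := cardsID S (f (A, B)); have := cardsID (f (A, B)) S.
    by rewrite finset.setIC E1 E2 (eqP Ah) (eqP Bh) => <- <-.
  by rewrite card_symdiff_eq ?Tl ?Sl// E1 E2 Ah Bh.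
rewrite card_in_imset => [|[A B] [A' B']]; last first.
  rewrite !inE /= => /andP[/andP[AS _] /andP[BS _]] /andP[/andP[AS' _] /andP[BS' _]] ff.
  have [E1 E2] := fP A B AS BS; have [E3 E4] := fP A' B' AS' BS'.
  by congr pair; [rewrite -E1 -E3 ff|rewrite -E2 -E4 ff].
by rewrite cardsX !cards_draws Sl cardsCs finset.setCK Sl card_ord mulnC.
Qed.

Variables (l p : nat).
Hypothesis p_even : ~~ odd p.

Definition ksubset (i : 'I_#|{: ksets n l}|) : {set 'I_n} := val (enum_val i).

(** [insub] gives [None] exactly when the symmetric difference does not have size [p], that is, at
    the entries set to zero. *)
Definition label (i j : 'I_#|{: ksets n l}|) : option (ksets n p) :=
  insub (symdiff (ksubset i) (ksubset j)).

Lemma card_ksubset i : #|ksubset i| = l.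
Proof. exact: eqP (valP (enum_val i)). Qed.

Lemma ksubset_inj : injective ksubset.
Proof. by move=> i j /val_inj /enum_val_inj. Qed.

Lemma labelP i j e : label i j = Some e -> symdiff (ksubset i) (ksubset j) = val e.
Proof. by rewrite /label; case: insubP => // u _ <- [->]. Qed.

Lemma label_inj i j j' e : label i j = Some e -> label i j' = Some e -> j = j'.
Proof.
move=> /labelP h /labelP h'; apply: ksubset_inj.
by rewrite -(symdiffK (ksubset i) (ksubset j)) h -h' symdiffK.
Qed.

Lemma label_sym i j : label i j = label j i.
Proof. by rewrite /label symdiffC. Qed.

Lemma card_label i : #|[pred j | label i j]| = ('C(n - l, p./2) * 'C(l, p./2))%N.
Proof.
rewrite -(card_symdiff_nbrs p./2 (card_ksubset i)) even_halfK//.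
rewrite -(card_imset _ ksubset_inj) -[in RHS]cardsE; apply: eq_card => T.
rewrite !inE; apply/imsetP/andP => [[j]|[Tl Tp]].
  rewrite inE /label; case: insubP => // u ep _ _ ->.
  by rewrite card_ksubset.
exists (enum_rank (exist _ T Tl : ksets n l)); last by rewrite /ksubset enum_rankK.
by rewrite inE /label /ksubset enum_rankK; case: insubP => //; rewrite Tp.
Qed.

Lemma symdiff_matrixE (R : nzRingType) (y : {set 'I_n} -> R) :
  symdiff_matrix l p y = \matrix_(i, j) oapp (fun e => y (val e)) 0 (label i j).
Proof.
apply/matrixP => i j; rewrite !mxE /label; case: insubP => /= [u -> <- //|].
by move=> /negbTE ->.
Qed.
End SymmetricDifference.

Lemma measurable_lambda_max d (T : measurableType d) (R : realType) m
    (M : T -> 'M[R]_m) : (0 < m)%N -> (forall w, (M w)^T = M w) ->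
  (forall i j, measurable_fun setT (fun w => M w i j)) ->
  measurable_fun setT (fun w => lambda_max (M w)).
Proof.
move=> m0 symM mM.
apply: (measurability _ (RGenOInfty.measurableE R)) => _ [_ [c ->] <-].
rewrite setTI -[X in measurable X]setCK; apply: measurableC.
have -> : ~` ((fun w => lambda_max (M w)) @^-1` `]c, +oo[) =
    ~` \bigcup_(q in [set: 'rV[rat]_m]) [set w | let u := map_mx (@ratr R) q in
       c * dot u u < dot (u *m M w) u].
  rewrite setC_bigcup; apply/seteqP; split => w /=.
    move=> /negP; rewrite in_itv /= andbT -leNgt.
    by move=> /(lambda_max_le_rat _ m0 (symM w)) H q _ /=; apply/negP; rewrite -leNgt.
  move=> H; apply/negP; rewrite in_itv /= andbT -leNgt.
  apply/(lambda_max_le_rat _ m0 (symM w)) => q /=.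
  by have /negP := H q I; rewrite -leNgt.
apply: measurableC; apply: countable_bigcupT_measurable => [|q] /=.
  exact: countableP.
set u := map_mx _ q.
have mdot : measurable_fun setT (fun w => dot (u *m M w) u).
  have -> : (fun w => dot (u *m M w) u) =
      (fun w => \sum_j (\sum_i u 0 i * M w i j) * u 0 j).
    by apply/funext => w; rewrite dotE; apply: eq_bigr => j _; rewrite mxE.
  apply: measurable_sum => j; apply: measurable_funM => //.
  by apply: measurable_sum => i; exact: measurable_funM.
rewrite (_ : [set w | _] = (fun w => dot (u *m M w) u) @^-1` `]c * dot u u, +oo[).
  by rewrite -[X in measurable X]setTI; exact: mdot.
by apply/seteqP; split => w /=; rewrite in_itv /= andbT.
Qed.

(** * The Rayleigh quotient at the planted vector *)

Section SpikedRayleigh.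
Variables (R : realType) (L : finType) (m D : nat).
Variable lab : 'I_m -> 'I_m -> option L.
Hypothesis lab_inj : forall i j j' e,
  lab i j = Some e -> lab i j' = Some e -> j = j'.
Hypothesis lab_deg : forall i, #|[pred j | lab i j]| = D.
Hypothesis m_gt0 : (0 < m)%N.

Definition label_count (e : L) : nat := (\sum_i \sum_j (lab i j == Some e))%N.

Lemma label_count_le e : (label_count e <= m)%N.
Proof.
rewrite -[leqRHS]card_ord -sum1_card; apply: leq_sum => i _.
have [/existsP[j je]|/existsPn h] := boolP [exists j, lab i j == Some e].
  rewrite (bigD1 j)//= je big1 ?addn0// => j' jj'; apply/eqP; rewrite eqb0.
  by apply: contra jj' => /eqP h; apply/eqP; apply: lab_inj h (eqP je).
by rewrite big1// => j _; apply/eqP; rewrite eqb0.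
Qed.

Lemma sum_labels (f : L -> R) :
  \sum_i \sum_j oapp f 0 (lab i j) = \sum_e (label_count e)%:R * f e.
Proof.
transitivity (\sum_i \sum_j \sum_e (lab i j == Some e)%:R * f e).
  apply: eq_bigr => i _; apply: eq_bigr => j _.
  case: (lab i j) => [e|] /=; last by rewrite big1// => e _; rewrite mul0r.
  rewrite (bigD1 e)//= eqxx mul1r big1 ?addr0// => e' ee'.
  by rewrite [Some e == _]eq_sym (inj_eq Some_inj) (negbTE ee') mul0r.
under eq_bigr do rewrite exchange_big /=.
rewrite exchange_big /=; apply: eq_bigr => e _.
rewrite /label_count natr_sum mulr_suml; apply: eq_bigr => i _.
by rewrite natr_sum mulr_suml.
Qed.

Lemma sum_labels_cst (c : R) : \sum_i \sum_j oapp (fun=> c) 0 (lab i j) = (m * D)%:R * c.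
Proof.
rewrite natrM -mulrA -[m in RHS]card_ord mulr_natl -sumr_const; apply: eq_bigr => i _.
rewrite -(lab_deg i) mulr_natl -sumr_const [RHS]big_mkcond /=.
by apply: eq_bigr => j _; rewrite inE; case: (lab i j).
Qed.

Variable s : L -> R.
Hypothesis s_sqr : forall e, s e ^+ 2 = 1.

(* The coefficient of the noise [g e] in the Rayleigh quotient at [u]. *)
Definition label_weight e : R := (label_count e)%:R * s e / m%:R.

(** Let [N_e] be the count of label [e]. Then [(N_e / m)^2 <= N_e / m] because [N_e <= m], and the
    counts sum to [m D]. *)
Lemma label_weight_sqr : \sum_e label_weight e ^+ 2 <= D%:R.
Proof.
have m0 : (0 : R) < m%:R by rewrite ltr0n.
have := sum_labels (fun=> 1); rewrite sum_labels_cst mulr1 => H.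
have -> : D%:R = (m * D)%:R / m%:R :> R by rewrite natrM mulrAC divff ?mul1r// gt_eqF.
rewrite H mulr_suml; apply: ler_sum => e _.
rewrite /label_weight !exprMn s_sqr !mulr1 exprVn ler_pdivlMr//.
rewrite expr2 -!mulrA ler_piMr// expr2 invfM -mulrA mulVf ?gt_eqF// mulr1.
by rewrite ler_pdivrMr// mul1r ler_nat label_count_le.
Qed.

Variables (u : 'I_m -> R) (g : L -> R) (lam : R).
Hypothesis u_sqr : forall i, u i ^+ 2 = 1.
Hypothesis u_lab : forall i j e, lab i j = Some e -> u i * u j = s e.
Hypothesis lab_sym : forall i j, lab i j = lab j i.

(** Since [u i * u j = s e], the signals add up coherently: the quadratic form at [u] is [m D lam]
    plus noise while the squared norm of [u] is [m], so a small eigenvalue forces the noise down. *)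
Lemma spiked_noise_le :
  lambda_max (\matrix_(i, j) oapp (fun e => lam * s e + g e) 0 (lab i j)) <=
    lam * D%:R / 2 ->
  \sum_e label_weight e * g e <= - (lam * D%:R / 2).
Proof.
set M := \matrix_(_, _) _ => lM.
have m0 : (0 : R) < m%:R by rewrite ltr0n.
have sM : M^T = M by apply/matrixP => i j; rewrite !mxE lab_sym.
have /(_ (\row_i u i)) := (lambda_max_le _ m_gt0 sM).1 lM.
rewrite !dotE.
have -> : \sum_i (\row_i u i *m M) 0 i * (\row_i u i) 0 i =
    \sum_i \sum_j oapp (fun e => lam + s e * g e) 0 (lab i j).
  rewrite exchange_big; apply: eq_bigr => j _; rewrite !mxE mulr_suml.
  apply: eq_bigr => i _; rewrite !mxE; case E : (lab i j) => [e|] /=; last by rewrite mulr0 mul0r.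
  rewrite mulrAC (u_lab E) mulrDr mulrCA -expr2 s_sqr mulr1//.
have -> : \sum_i (\row_i u i) 0 i * (\row_i u i) 0 i = m%:R :> R.
  under eq_bigr do rewrite mxE -expr2 u_sqr.
  by rewrite sumr_const card_ord.
have -> : \sum_i \sum_j oapp (fun e => lam + s e * g e) 0 (lab i j) =
    (m * D)%:R * lam + \sum_e (label_count e)%:R * (s e * g e).
  rewrite -sum_labels -sum_labels_cst -big_split; apply: eq_bigr => i _.
  by rewrite -big_split; apply: eq_bigr => j _; case: (lab i j) => [e|] //=; rewrite addr0.
have -> : \sum_e label_weight e * g e = (\sum_e (label_count e)%:R * (s e * g e)) / m%:R.
  by rewrite mulr_suml; apply: eq_bigr => e _; rewrite /label_weight; ring.
by rewrite ler_pdivrMr// natrM; lra.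
Qed.
End SpikedRayleigh.

Lemma prod_symdiff (R : realType) n (f : 'I_n -> R) (S T : {set 'I_n}) :
  (forall i, f i ^+ 2 = 1) ->
  (\prod_(i in S) f i) * (\prod_(i in T) f i) = \prod_(i in symdiff S T) f i.
Proof.
move=> f2; rewrite [X in X * _]big_mkcond [X in _ * X]big_mkcond -big_split.
rewrite [RHS]big_mkcond; apply: eq_bigr => i _; rewrite !inE /=.
case: (i \in S); case: (i \in T) => /=; rewrite ?mulr1 ?mul1r//.
by rewrite -expr2.
Qed.

Lemma sign_sqr (R : realType) b : sign R b ^+ 2 = 1.
Proof. by case: b; rewrite /sign ?sqrrN expr1n. Qed.

Lemma bin_le_exp n k : ('C(n, k) <= n ^ k)%N.
Proof.
apply: (@leq_trans (n ^_ k)); first by rewrite -bin_ffact leq_pmulr ?fact_gt0.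
elim: k => [|k IH]; first by rewrite ffactn0 expn0.
by rewrite ffactnSr expnSr leq_mul ?leq_subr.
Qed.

(** * The two error probabilities in the tensor model *)

Section Model.
Context d (T : measurableType d) (R : realType) (P : probability T R).
Variables (n p l : nat).
Variables (G : {set 'I_n} -> {RV P >-> R}) (x : 'I_n -> {RV P >-> R}) (lam : R).
Hypothesis p_even : ~~ odd p.
Hypothesis p_gt0 : (0 < p)%N.
Hypothesis model : rad_spiked_model p G x.
Hypothesis pl : (p./2 <= l)%N.
Hypothesis ln : (l <= n - p./2)%N.
Hypothesis lam0 : 0 <= lam.

Local Notation m := #|{: ksets n l}|.
Local Notation GL := (fun e : ksets n p => G (val e)).
Local Notation lab := (@label n l p).

Let half_gt0 : (0 < p./2)%N.
Proof. by case: p p_even p_gt0 => [|[|k]]. Qed.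

Let card_gt0 : (0 < m)%N.
Proof. by rewrite card_ksets bin_gt0 (leq_trans ln) ?leq_subr. Qed.

Let deg_gt0 : (0 < 'C(n - l, p./2) * 'C(l, p./2))%N.
Proof. by rewrite muln_gt0 !bin_gt0 pl andbT; lia. Qed.

Let normG e (B : set R) : measurable B -> P (GL e @^-1` B) = normal_prob 0 1 B.
Proof. by case: model => H _ _ mB; apply: H => //; exact: eqP (valP e). Qed.

Let indG : mutually_independent GL.
Proof.
case: model => _ _ ind B mB.
(* Independence of the noise alone: the events on the signs are taken to be the whole line, of
   probability 1. *)
pose B' (k : (ksets n p + 'I_n)%type) : set R :=
  match k with inl e => B e | inr _ => setT end.
have := ind B' (fun k => match k with inl e => mB e | inr _ => measurableT end).
rewrite big_sumType /= [X in (_ * X)%E]big1 ?mule1; last first.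
  by move=> i _; rewrite preimage_setT probability_setT.
move=> <-; congr (P _); apply/seteqP; split => w /= H k _.
  by case: k => [e|i] //; exact: H.
exact: (H (inl k)).
Qed.

Let card_le : (m%:R : R) <= n%:R ^+ l.
Proof. by rewrite card_ksets -natrX ler_nat bin_le_exp. Qed.

Let symM (y : {set 'I_n} -> R) : (symdiff_matrix l p y)^T = symdiff_matrix l p y.
Proof. by apply/matrixP => i j; rewrite !mxE symdiffC. Qed.

Lemma measurable_lambda_max_obs (c : R) :
  measurable_fun setT (fun w => lambda_max (symdiff_matrix l p (obs G x c w))).
Proof.
apply: measurable_lambda_max => // i j.
have -> : (fun w => symdiff_matrix l p (obs G x c w) i j) =
    (fun w => oapp (fun e => obs G x c w (val e)) 0 (lab i j)).
  by apply/funext => w; rewrite symdiff_matrixE mxE.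
case: (lab i j) => [e|] //=; rewrite /obs.
apply: measurable_funD => //; apply: measurable_funM => //.
under eq_fun do rewrite -big_filter.
exact: measurable_prod.
Qed.

Lemma measurable_lambda_max_ge (c t : R) : measurable
  [set w | t <= lambda_max (symdiff_matrix l p (obs G x c w))].
Proof.
rewrite (_ : [set w | _] =
  (fun w => lambda_max (symdiff_matrix l p (obs G x c w))) @^-1` `[t, +oo[).
  by rewrite -[X in measurable X]setTI; exact: measurable_lambda_max_obs.
by apply/seteqP; split => w /=; rewrite in_itv /= andbT.
Qed.

Lemma measurable_lambda_max_le (c t : R) : measurable
  [set w | lambda_max (symdiff_matrix l p (obs G x c w)) <= t].
Proof.
rewrite (_ : [set w | _] =
  (fun w => lambda_max (symdiff_matrix l p (obs G x c w))) @^-1` `]-oo, t]).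
  by rewrite -[X in measurable X]setTI; exact: measurable_lambda_max_obs.
by apply/seteqP; split => w /=; rewrite in_itv.
Qed.

Lemma lambda_max_null_tail :
  (P [set w | (lam * dl R n l p / 2 <=
      lambda_max (symdiff_matrix l p (obs G x 0 w)))%R] <=
   (2 * n%:R ^+ l * expR (- (lam ^+ 2 * dl R n l p / 8)))%:E)%E.
Proof.
have ME w : symdiff_matrix l p (obs G x 0 w) = labelled_mx GL lab w.
  rewrite symdiff_matrixE; apply/matrixP => i j; rewrite !mxE.
  by case: (lab i j) => [e|] //=; rewrite /obs mul0r add0r.
have mA := measurable_lambda_max_ge 0 (lam * dl R n l p / 2).
have AE : [set w | lam * dl R n l p / 2 <= lambda_max (symdiff_matrix l p (obs G x 0 w))] =
    [set w | lam * dl R n l p / 2 <= lambda_max (labelled_mx GL lab w)].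
  by apply/seteqP; split => w /=; rewrite ME.
rewrite AE in mA *.
have deg i : (#|[pred j | lab i j]| <= 'C(n - l, p./2) * 'C(l, p./2))%N.
  by rewrite card_label.
apply: (le_trans (lambda_max_tail normG indG (@label_inj n l p) deg (@label_sym n l p)
  card_gt0 deg_gt0 lam0 mA)).
by rewrite lee_fin ler_wpM2r ?expR_ge0// ler_wpM2l.
Qed.

Lemma lambda_max_spiked_tail :
  (P [set w | (lambda_max (symdiff_matrix l p (obs G x lam w)) <=
      lam * dl R n l p / 2)%R] <=
   (2 * n%:R ^+ l * expR (- (lam ^+ 2 * dl R n l p / 8)))%:E)%E.
Proof.
have [_ radx ind] := model; set A := [set w | _].
have mA : measurable A by exact: measurable_lambda_max_le.
pose sp (s : {ffun 'I_n -> bool}) (e : ksets n p) : R := \prod_(i in val e) sign R (s i).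
have prod_sqr (s : {ffun 'I_n -> bool}) (E : {set 'I_n}) :
    (\prod_(i in E) sign R (s i)) ^+ 2 = 1.
  by rewrite -prodrXl big1// => i _; exact: sign_sqr.
have deg (i : 'I_m) := card_label p_even i.
(* The tilt [lam / 2] is the optimal one, the deviation [lam * d_l / 2] divided by the variance
   bound [d_l]. *)
have := @spiked_chernoff _ _ _ P _ _ GL x normG radx ind
  (fun s => label_weight lab (sp s)) (dl R n l p) (lam * dl R n l p / 2) (lam / 2) A mA.
have lam20 : 0 <= lam / 2 by rewrite divr_ge0.
move=> /(_ lam20) H; apply: le_trans (H _ _) _.
- move=> s; apply: label_weight_sqr => //.
  + exact: (@label_inj n l p).
  + by move=> e; exact: prod_sqr.
- move=> w s Aw xs.
  have H1 := @spiked_noise_le _ _ _ _ lab deg card_gt0 (sp s) _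
    (fun i => \prod_(a in ksubset i) sign R (s a)) (fun e => G (val e) w) lam.
  apply: H1.
  + by move=> e; exact: prod_sqr.
  + by move=> i; exact: prod_sqr.
  + move=> i j e ij; rewrite prod_symdiff ?(labelP ij)// => a; exact: sign_sqr.
  + exact: (@label_sym n l p).
  + suff <- : symdiff_matrix l p (obs G x lam w) = \matrix_(i, j)
        oapp (fun e => lam * sp s e + G (val e) w) 0 (lab i j) by [].
    rewrite symdiff_matrixE; apply/matrixP => i j; rewrite !mxE.
    case: (lab i j) => [e|] //=; rewrite /obs; congr (_ * _ + _).
    by apply: eq_bigr => a _; exact: xs.
rewrite lee_fin.
have -> : (lam / 2) ^+ 2 * dl R n l p / 2 - lam / 2 * (lam * dl R n l p / 2) =
    - (lam ^+ 2 * dl R n l p / 8) by field.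
(* The Chernoff bound has prefactor 1; it is weakened to the common form through [1 <= m <= n^l]. *)
rewrite ler_peMl ?expR_ge0//; apply: (@le_trans _ _ m%:R); last first.
  by apply: le_trans card_le _; rewrite ler_peMl ?exprn_ge0// ler1n.
by rewrite ler1n.
Qed.
End Model.

(** * The finite-size bound and strong detection *)

Unset Implicit Arguments.
Set Strict Implicit.

Theorem theorem2 (R : realType) (p : nat) (p_even : ~~ odd p) (p_gt0 : (0 < p)%N) :
  (* non-asymptotic bound *)
  (forall (d : measure_display) (T : measurableType d) (P : probability T R)
          (n l : nat) (G : {set 'I_n} -> {RV P >-> R}) (x : 'I_n -> {RV P >-> R})
          (lam : R),
     rad_spiked_model p G x ->
     (p./2 <= l)%N -> (l <= n - p./2)%N -> 0 <= lam ->
     (maxe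
        (P [set w | (lam * dl R n l p / 2 <=
                    lambda_max (symdiff_matrix l p (obs G x 0 w)))%R])
        (P [set w | (lambda_max (symdiff_matrix l p (obs G x lam w)) <=
                    lam * dl R n l p / 2)%R])
      <= (2 * n%:R ^+ l * expR (- (lam ^+ 2 * dl R n l p / 8)))%:E)%E)
  /\
  (* consequence: strong detection *)
  (forall (d : measure_display) (T : nat -> measurableType d)
          (P : forall n, probability (T n) R)
          (G : forall n, {set 'I_n} -> {RV P n >-> R})
          (x : forall n, 'I_n -> {RV P n >-> R})
          (lam : nat -> R) (l : nat -> nat),
     (forall n, rad_spiked_model p (G n) (x n)) ->
     (forall n, 0 <= lam n) ->
     (\forall n \near \oo, (p./2 <= l n)%N && (l n <= n - p./2)%N) ->
     ((lam n ^+ 2 * dl R n (l n) p / 8 - (l n)%:R * ln (n%:R : R))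
        @[n --> \oo] --> +oo) ->
     (P n [set w | lam n * dl R n (l n) p / 2 <=
                   lambda_max (symdiff_matrix (l n) p (obs (G n) (x n) (lam n) w))])
        @[n --> \oo] --> 1%E
     /\
     (P n [set w | ~ (lam n * dl R n (l n) p / 2 <=
                   lambda_max (symdiff_matrix (l n) p (obs (G n) (x n) 0 w)))])
        @[n --> \oo] --> 1%E).
Proof.
split=> [d T P n l G x lam model pl ln lam0|d T P G x lam l model lam0 Hl Hlim].
  rewrite ge_max; apply/andP; split; first exact: (lambda_max_null_tail p_even p_gt0 model).
  exact: (lambda_max_spiked_tail p_even model).
pose B n := 2 * n%:R ^+ l n * expR (- (lam n ^+ 2 * dl R n (l n) p / 8)).
(* Together with [p./2 <= l n <= n - p./2] this forces [0 < n], so that [n ^ l] can be written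
   [exp (l ln n)]. *)
have half_gt0 : (0 < p./2)%N by case: (p) p_even p_gt0 => [|[|k]].
have B0 : B n @[n --> \oo] --> (0 : R).
  have H0 : 2 * expR (- (lam n ^+ 2 * dl R n (l n) p / 8 - (l n)%:R * ln (n%:R : R)))
      @[n --> \oo] --> (0 : R).
    rewrite -[X in _ --> X](mulr0 2); apply: cvgM; first exact: cvg_cst.
    exact: (cvg_comp _ _ Hlim (@cvgr_expR R)).
  apply: cvg_trans H0; apply: near_eq_cvg; near=> n.
  have n0 : (0 : R) < n%:R.
    have /andP[h1 h2] : (p./2 <= l n)%N && (l n <= n - p./2)%N by near: n.
    by rewrite ltr0n; lia.
  have -> : B n = 2 * (expR ((l n)%:R * ln n%:R) * expR (- (lam n ^+ 2 * dl R n (l n) p / 8))).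
    by rewrite /B mulrA expRM_natl lnK ?posrE.
  by rewrite -expRD; congr (2 * expR _); ring.
have squeeze (A : forall n, set (T n)) :
    (\forall n \near \oo, d.-measurable (A n) /\ (P n (~` A n) <= (B n)%:E)%E) ->
    P n (A n) @[n --> \oo] --> 1%E.
  move=> PA.
  apply: (@squeeze_cvge _ _ _ _ (fun n => (1 - B n)%:E) _ (cst 1%E)).
  - near=> n; have [mA PB] : d.-measurable (A n) /\ (P n (~` A n) <= (B n)%:E)%E.
      by near: n.
    rewrite /= probability_le1// andbT.
    rewrite -[X in P n X]setCK probability_setC; last exact: measurableC.
    by rewrite EFinB leeB.
  - apply: cvg_EFin; first exact: nearW.
    by have := @cvgB _ R^o _ _ _ _ _ _ _ (cvg_cst (1 : R)) B0; rewrite subr0; exact.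
  - exact: cvg_cst.
split; apply: squeeze; near=> n;
  have /andP[h1 h2] : (p./2 <= l n)%N && (l n <= n - p./2)%N by near: n.
- split; first by apply: measurable_lambda_max_ge.
  have S := lambda_max_spiked_tail p_even (model n) h2 (lam0 n).
  apply: le_trans S.
  apply: le_measure; rewrite ?inE.
  + by apply: measurableC; apply: measurable_lambda_max_ge.
  + by apply: measurable_lambda_max_le.
  + by move=> w /= /negP; rewrite -ltNge => /ltW.
- split.
    by apply: measurableC; apply: measurable_lambda_max_ge.
  have S := lambda_max_null_tail p_even p_gt0 (model n) h1 h2 (lam0 n).
  apply: le_trans S.
  by rewrite setCK.
Unshelve. all: by end_near.
Qed.
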